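(* Let $n\ge 1$ be a fixed integer, let $\varphi_n$ be the function on $(0,\infty)$ defined recursively in the context, and let $s=\sigma+it$ with $\sigma,t\in\mathbb{R}$ and $0<\sigma<1$. Then $$\frac{\zeta^n(s)}{(-s)^n} = \int_0^\infty \varphi_n(x)\,x^{-1-s}\,dx.$$
   Context: $\zeta(s)$ denotes the Riemann zeta-function (given by $\sum_{n\ge1} n^{-s}$ for $\Re s>1$ and by analytic continuation elsewhere), and $\zeta^n(s)=(\zeta(s))^n$. $\{x\} = x-[x]$ denotes the fractional part of the real number $x$, where $[x]$ is the greatest integer not exceeding $x$. The functions $\varphi_n:(0,\infty)\to\mathbb{R}$ are defined by $$\varphi_1(x) := \{x\},\qquad \varphi_n(x) := \int_0^\infty \{u\}\,\varphi_{n-1}\Bigl(\frac{x}{u}\Bigr)\,\frac{du}{u}\quad(n\ge 2).$$ *)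

(* Defs.v *)
From HB Require Import structures.
From mathcomp Require Import all_boot all_order all_algebra.
From mathcomp Require Import all_classical all_reals all_analysis.
From mathcomp Require Import complex.

Set Implicit Arguments.
Unset Strict Implicit.
Unset Printing Implicit Defensive.

Import Order.TTheory GRing.Theory Num.Theory.
Import numFieldNormedType.Exports.

Local Open Scope classical_set_scope.
Local Open Scope ring_scope.
Local Open Scope complex_scope.

Section Definitions.
Variable R : realType.
Local Notation mu := (@lebesgue_measure R).

Definition fract_part (x : R) : R := x - (Num.floor x)%:~R.

(* The functions are indexed from 1; the value at n = 0 is a dummy that is
   never reached from n >= 1.  \int in ring_scope is the real-valued Lebesgue
   integral. *)
Fixpoint phi (n : nat) : R -> R :=
  match n with
  | 0 => fun=> 0
  | m.+1 =>
      match m with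
      | 0 => fract_part
      | _.+1 => fun x =>
          \int[mu]_(u in `]0, +oo[) (fract_part u * phi m (x / u) / u)
      end
  end.

(* x ^ z = exp (z log x), for x > 0 real and z complex.  The bare names Re and
   Im are the R[i]-valued projections; complex.Re and complex.Im the R-valued
   ones. *)
Definition cpow (x : R) (z : R[i]) : R[i] :=
  (x `^ complex.Re z * cos (complex.Im z * ln x)) +i*
  (x `^ complex.Re z * sin (complex.Im z * ln x)).

Definition cintegrable (D : set R) (f : R -> R[i]) : Prop :=
  mu.-integrable D (fun x => (complex.Re (f x))%:E) /\
  mu.-integrable D (fun x => (complex.Im (f x))%:E).

Definition cintegral (D : set R) (f : R -> R[i]) : R[i] :=
  (\int[mu]_(x in D) complex.Re (f x)) +i*
  (\int[mu]_(x in D) complex.Im (f x)).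

(* R[i]^o is R[i] seen as a normed module over itself, which is what carries
   the usual topology of the complex plane. *)
Definition analytic_at (f : R[i] -> R[i]) (z0 : R[i]) : Prop :=
  exists a : nat -> R[i], \forall z \near (z0 : R[i]^o),
    (series (fun k => a k * (z - z0) ^+ k) : nat -> R[i]^o) @ \oo
      --> (f z : R[i]^o).

(* The Dirichlet series on Re s > 1 and its analytic continuation to the
   complex plane minus {1}.  As this domain is connected, these two properties
   determine zeta s for every s != 1; the value at the pole is unconstrained. *)
Definition is_riemann_zeta (zeta : R[i] -> R[i]) : Prop :=
  (forall s : R[i], 1 < complex.Re s ->
     (series (fun k => cpow k.+1%:R (- s)) : nat -> R[i]^o) @ \oo
       --> (zeta s : R[i]^o)) /\
  (forall s : R[i], s != 1 -> analytic_at zeta s).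

End Definitions.

(* Main.v *)
Require Import Defs.
From mathcomp Require Import all_boot all_order all_algebra.
From mathcomp Require Import all_classical all_reals all_analysis.
From mathcomp Require Import measurable_realfun complex ring.

(** The Mellin transform [f |-> \int_0^oo f(x) x^(-1-s) dx] turns multiplicative
    convolution into product.  The recursion defining [phi] says that
    [phi n.+1] is the convolution of [phi 1], the fractional part, with
    [phi n]; so the transform of [phi n] is the [n]-th power of that of the
    fractional part, and the theorem reduces to the case [n = 1], the classical
    formula [zeta s / (- s) = \int_0^oo {x} x^(-1-s) dx] of the critical strip
    ([zeta_mellin]).

    The product formula ([Rintegral_mconv], [cintegral_mconv]) is the theorem of
    Fubini followed by the substitution [x = u y].  The functions [phi n] are
    nonnegative and [x^(-1-sigma)] is multiplicative, so Tonelli gives the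
    absolute convergence of the double integral as the product of two finite
    integrals.  This also shows that the integral defining [phi n.+1 x] is
    finite for almost every [x], so no pointwise bound on [phi n] has to be
    found.

    For [n = 1] and [1 < Re s], integrating over each [[k, k + 1[] and summing
    yields [zeta s = 1 - 1 / (1 - s) - s \int_1^oo {x} x^(-1-s) dx]
    ([zeta_mellin_cy]).  Both sides are analytic on [0 < Re s] away from [1].
    Since [zeta] is known there only through its local power series, the
    identity is propagated along one horizontal line at a time, where it
    concerns functions of one real variable: a function that is locally the sum
    of a power series and vanishes far to the right vanishes everywhere
    ([locally_series_identity]).  The integral is locally such a sum because
    [x^(-h) = \sum_k (- h ln x)^k / k!] may be integrated term by term
    ([locally_series_mellin]).  The real line is the only one that meets the
    pole; real [s] is obtained as the limit of [s + i / (m + 1)].  In the strip,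
    finally, [\int_0^1 x^(-s) dx = 1 / (1 - s)] absorbs the polar term. *)

Set Implicit Arguments.
Unset Strict Implicit.
Unset Printing Implicit Defensive.

Import Order.TTheory GRing.Theory Num.Theory.
Import numFieldNormedType.Exports.

Local Open Scope classical_set_scope.
Local Open Scope ring_scope.
Local Open Scope complex_scope.

(** * Complex numbers and complex powers by real and imaginary parts *)

Section ComplexParts.
Variable R : realType.
Implicit Types (x y : R) (z w s : R[i]).

Lemma complex_eqP z w :
  complex.Re z = complex.Re w -> complex.Im z = complex.Im w -> z = w.
Proof. by case: z w => [a b] [c d] /= -> ->. Qed.

Lemma cReD z w : complex.Re (z + w) = complex.Re z + complex.Re w.
Proof. by case: z w => [? ?] [? ?]. Qed.

Lemma cImD z w : complex.Im (z + w) = complex.Im z + complex.Im w.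
Proof. by case: z w => [? ?] [? ?]. Qed.

Lemma cReN z : complex.Re (- z) = - complex.Re z.
Proof. by case: z => [? ?]. Qed.

Lemma cImN z : complex.Im (- z) = - complex.Im z.
Proof. by case: z => [? ?]. Qed.

Lemma cReM z w : complex.Re (z * w) =
  complex.Re z * complex.Re w - complex.Im z * complex.Im w.
Proof. by case: z w => [? ?] [? ?]. Qed.

Lemma cImM z w : complex.Im (z * w) =
  complex.Re z * complex.Im w + complex.Im z * complex.Re w.
Proof. by case: z w => [? ?] [? ?]. Qed.

Definition cpartE := (cReD, cImD, cReN, cImN, cReM, cImM).

Lemma subr1_neq0 s : complex.Re s != 1 -> 1 - s != 0.
Proof.
apply: contra => /eqP /(congr1 (@complex.Re R)).
by rewrite !cpartE => /eqP; rewrite subr_eq0 eq_sym.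
Qed.

Lemma cpowM x y z : 0 < x -> 0 < y -> cpow (x * y) z = cpow x z * cpow y z.
Proof.
move=> x0 y0; apply: complex_eqP; rewrite !cpartE /=;
  rewrite lnM ?posrE// powRM ?ltW// mulrDr ?cosD ?sinD; ring.
Qed.

Lemma cpowD x z w : 0 < x -> cpow x (z + w) = cpow x z * cpow x w.
Proof.
move=> x0; apply: complex_eqP; rewrite !cpartE /=;
  rewrite !cpartE powRD ?(gt_eqF x0) ?implybT// mulrDl ?cosD ?sinD; ring.
Qed.

Lemma cpow1r x : 0 < x -> cpow x 1 = x%:C.
Proof.
by move=> x0; apply: complex_eqP; rewrite /= powRr1 ?ltW// mul0r ?cos0 ?sin0;
  rewrite ?mulr1 ?mulr0.
Qed.

Lemma cpow1l z : cpow (1 : R) z = 1.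
Proof.
by apply: complex_eqP; rewrite /= ln1 mulr0 powR1 ?cos0 ?sin0 ?mulr1 ?mulr0.
Qed.

Lemma normr_Re_cpow x z : `|complex.Re (cpow x z)| <= x `^ complex.Re z.
Proof.
rewrite /= normrM ger0_norm ?powR_ge0// ler_piMr ?powR_ge0//.
by rewrite ler_norml cos_geN1 cos_le1.
Qed.

Lemma normr_Im_cpow x z : `|complex.Im (cpow x z)| <= x `^ complex.Re z.
Proof.
rewrite /= normrM ger0_norm ?powR_ge0// ler_piMr ?powR_ge0//.
by rewrite ler_norml sin_geN1 sin_le1.
Qed.

Lemma measurable_Re_cpow z : measurable_fun [set: R] (fun x => complex.Re (cpow x z)).
Proof.
apply: measurable_funM; first exact: measurable_powR.
apply: measurableT_comp; first exact: continuous_measurable_fun (@continuous_cos R).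
by apply: measurable_funM => //; exact: measurable_ln.
Qed.

Lemma measurable_Im_cpow z : measurable_fun [set: R] (fun x => complex.Im (cpow x z)).
Proof.
apply: measurable_funM; first exact: measurable_powR.
apply: measurableT_comp; first exact: continuous_measurable_fun (@continuous_sin R).
by apply: measurable_funM => //; exact: measurable_ln.
Qed.

End ComplexParts.

(** * Integrals and limits of complex-valued functions *)

Section ComplexIntegral.
Variable R : realType.
Local Notation mu := (@lebesgue_measure R).
Local Notation RT := (measurableTypeR R).
Implicit Types (D E : set RT) (f g : R -> R[i]) (c : R[i]).

(** Here and below the domains are sets of [measurableTypeR R], the measurable
    space on which the Lebesgue measure is defined. *)
Lemma integrable_dominated D (h k : RT -> R) : measurable D ->
  measurable_fun D k -> mu.-integrable D (EFin \o h) ->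
  (forall x, D x -> `|k x| <= h x) -> mu.-integrable D (EFin \o k).
Proof.
move=> mD mk ih kh; apply: (le_integrable mD _ _ ih); first exact/measurable_EFinP.
by move=> x Dx /=; rewrite lee_fin (le_trans (kh _ Dx))// ler_norm.
Qed.

Lemma eq_integrable_fin D (h k : RT -> R) : measurable D ->
  (forall x, D x -> k x = h x) ->
  mu.-integrable D (EFin \o h) -> mu.-integrable D (EFin \o k).
Proof.
move=> mD kh; apply: (eq_integrable mD).
by move=> x /[!inE] Dx /=; rewrite kh.
Qed.

Lemma integrable_finD D (h k : RT -> R) : measurable D ->
  mu.-integrable D (EFin \o h) -> mu.-integrable D (EFin \o k) ->
  mu.-integrable D (EFin \o (fun x => h x + k x)).
Proof. by move=> mD ih ik; exact: (integrableD mD ih ik). Qed.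

Lemma integrable_finB D (h k : RT -> R) : measurable D ->
  mu.-integrable D (EFin \o h) -> mu.-integrable D (EFin \o k) ->
  mu.-integrable D (EFin \o (fun x => h x - k x)).
Proof. by move=> mD ih ik; exact: (integrableB mD ih ik). Qed.

Lemma integrable_finZ D (a : R) (h : RT -> R) : measurable D ->
  mu.-integrable D (EFin \o h) -> mu.-integrable D (EFin \o (fun x => a * h x)).
Proof. by move=> mD ih; exact: (integrableZl mD a ih). Qed.

Lemma cintegrable_dominated D f (h : R -> R) : measurable D ->
  measurable_fun D (fun x => complex.Re (f x)) ->
  measurable_fun D (fun x => complex.Im (f x)) ->
  mu.-integrable D (EFin \o h) ->
  (forall x, D x -> `|complex.Re (f x)| <= h x) ->
  (forall x, D x -> `|complex.Im (f x)| <= h x) ->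
  cintegrable D f.
Proof.
move=> mD mr mi ih hr hi.
by split; [exact: integrable_dominated mr ih hr|exact: integrable_dominated mi ih hi].
Qed.

Lemma eq_cintegral D g f : (forall x, D x -> f x = g x) ->
  cintegral D f = cintegral D g.
Proof.
by move=> fg; apply: complex_eqP => /=; apply: eq_Rintegral => x /[!inE] Dx;
  rewrite fg.
Qed.

Lemma eq_cintegrable D g f : measurable D -> (forall x, D x -> f x = g x) ->
  cintegrable D g -> cintegrable D f.
Proof.
move=> mD fg [gr gi]; split.
- by apply: (eq_integrable_fin mD _ gr) => // x Dx; rewrite fg.
- by apply: (eq_integrable_fin mD _ gi) => // x Dx; rewrite fg.
Qed.

Lemma cintegrableD D f g : measurable D -> cintegrable D f ->
  cintegrable D g -> cintegrable D (fun x => f x + g x).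
Proof.
move=> mD [fr fi] [gr gi]; split.
- apply: (eq_integrable_fin mD _ (integrable_finD mD fr gr)) => x _ /=.
  by rewrite cReD.
- apply: (eq_integrable_fin mD _ (integrable_finD mD fi gi)) => x _ /=.
  by rewrite cImD.
Qed.

Lemma cintegralD D f g : measurable D -> cintegrable D f ->
  cintegrable D g ->
  cintegral D (fun x => f x + g x) = cintegral D f + cintegral D g.
Proof.
move=> mD [fr fi] [gr gi]; apply: complex_eqP => /=.
- by under eq_Rintegral do rewrite cReD; rewrite RintegralD.
- by under eq_Rintegral do rewrite cImD; rewrite RintegralD.
Qed.

Lemma cintegrableZl D c f : measurable D -> cintegrable D f ->
  cintegrable D (fun x => c * f x).
Proof.
move=> mD [fr fi]; split.
- apply: (eq_integrable_fin mD _ (integrable_finB mD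
    (integrable_finZ (complex.Re c) mD fr)
    (integrable_finZ (complex.Im c) mD fi))) => x _ /=.
  by rewrite cReM.
- apply: (eq_integrable_fin mD _ (integrable_finD mD
    (integrable_finZ (complex.Re c) mD fi)
    (integrable_finZ (complex.Im c) mD fr))) => x _ /=.
  by rewrite cImM.
Qed.

Lemma cintegralZl D c f : measurable D -> cintegrable D f ->
  cintegral D (fun x => c * f x) = c * cintegral D f.
Proof.
move=> mD [fr fi]; apply: complex_eqP; rewrite !cpartE /=.
- under eq_Rintegral do rewrite cReM.
  by rewrite RintegralB ?RintegralZl//; exact: integrable_finZ.
- under eq_Rintegral do rewrite cImM.
  by rewrite RintegralD ?RintegralZl//; exact: integrable_finZ.
Qed.

Lemma cintegrableS D E f : measurable D -> measurable E -> E `<=` D ->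
  cintegrable D f -> cintegrable E f.
Proof. by move=> mD mE ED [fr fi]; split; [exact: integrableS fr|exact: integrableS fi]. Qed.

Lemma cintegral_setU D E f : measurable D -> measurable E ->
  [disjoint D & E] -> cintegrable (D `|` E) f ->
  cintegral (D `|` E) f = cintegral D f + cintegral E f.
Proof.
by move=> mD mE DE [fr fi]; apply: complex_eqP => /=; rewrite Rintegral_setU.
Qed.

Lemma cintegral_bndo_bndc (a b : R) (f : R -> R[i]) : cintegrable `[a, b[ f ->
  cintegral `[a, b[ f = cintegral `[a, b] f.
Proof.
by move=> [fr fi]; apply: complex_eqP => /=; rewrite Rintegral_itv_bndo_bndc.
Qed.

(** Convergence in [R[i]^o] is only met in the hypotheses on [zeta]; by
    [cvg_ccvg] it is turned once and for all into this convergence of parts,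
    for which the limit theorems on [R] apply directly. *)
Definition ccvg (u : nat -> R[i]) (l : R[i]) : Prop :=
  (fun n => complex.Re (u n)) @ \oo --> complex.Re l /\
  (fun n => complex.Im (u n)) @ \oo --> complex.Im l.

Lemma ccvg_cst c : ccvg (fun=> c) c.
Proof. by split; exact: cvg_cst. Qed.

Lemma ccvgD u v l m : ccvg u l -> ccvg v m -> ccvg (fun n => u n + v n) (l + m).
Proof.
move=> [ur ui] [vr vi]; split; rewrite cpartE.
- by under eq_fun do rewrite cReD; exact: cvgD.
- by under eq_fun do rewrite cImD; exact: cvgD.
Qed.

Lemma ccvgM u v l m : ccvg u l -> ccvg v m -> ccvg (fun n => u n * v n) (l * m).
Proof.
move=> [ur ui] [vr vi]; split; rewrite cpartE.
- by under eq_fun do rewrite cReM; apply: cvgB; exact: cvgM.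
- by under eq_fun do rewrite cImM; apply: cvgD; exact: cvgM.
Qed.

Lemma ccvgZ c u l : ccvg u l -> ccvg (fun n => c * u n) (c * l).
Proof. by move=> ul; exact: ccvgM (ccvg_cst c) ul. Qed.

Lemma ccvg_unique u l m : ccvg u l -> ccvg u m -> l = m.
Proof.
move=> [ur ui] [vr vi].
by apply: complex_eqP; [exact: cvg_unique ur vr|exact: cvg_unique ui vi].
Qed.

Lemma cvg_ccvg (u : nat -> R[i]) l :
  (u : nat -> R[i]^o) @ \oo --> (l : R[i]^o) -> ccvg u l.
Proof.
move=> /cvgrPdist_lt h.
have {}h e : 0 < e -> \forall n \near \oo, `|l - u n| < e%:C.
  by move=> e0; apply: h; rewrite ltcR.
split; apply/cvgrPdist_lt => e e0; near=> n.
- have : `|l - u n| < e%:C by near: n; exact: h.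
  move/(le_lt_trans (normc_ge_Re _)).
  by rewrite ltcR !cpartE.
- have : `|l - u n| < e%:C by near: n; exact: h.
  rewrite -ltcR; apply: le_lt_trans.
  have := normc_ge_Re ((l - u n) * 'i).
  by rewrite ReiNIm normrN !cpartE normrM (_ : `|'i%C : R[i]| = 1) ?mulr1//
     normc_def /= expr0n expr1n add0r sqrtr1.
Unshelve. all: by end_near. Qed.

Lemma cvg_Rintegral_dominated D (u_ : nat -> RT -> R) (u v : RT -> R) :
  measurable D -> (forall n, measurable_fun D (u_ n)) -> measurable_fun D u ->
  (forall x, D x -> u_ ^~ x @ \oo --> u x) ->
  mu.-integrable D (EFin \o v) ->
  (forall n x, D x -> `|u_ n x| <= v x) ->
  (fun n => \int[mu]_(x in D) u_ n x) @ \oo --> \int[mu]_(x in D) u x.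
Proof.
move=> mD mu_ mu' u_u iv uv.
have iu : mu.-integrable D (EFin \o u).
  apply: (integrable_dominated mD mu' iv) => x Dx.
  by apply: (cvgr_to_le (cvg_norm (u_u _ Dx))); apply: nearW => n; exact: uv.
apply: fine_cvg; rewrite fineK; last exact: integrable_fin_num.
have [] // := @dominated_convergence _ _ _ mu D mD
  (fun n => EFin \o u_ n) (EFin \o u) (EFin \o v).
- by move=> n; exact/measurable_EFinP.
- exact/measurable_EFinP.
- by apply: aeW => x Dx; apply: cvg_EFin; [exact: nearW|exact: u_u].
- by apply: aeW => x n Dx /=; rewrite lee_fin uv.
Qed.

Lemma cvg_Rintegral_exhaust D (E : nat -> set R) (u : R -> R) :
  measurable D -> (forall n, measurable (E n)) -> (forall n, E n `<=` D) ->
  (forall x, D x -> \forall n \near \oo, E n x) ->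
  mu.-integrable D (EFin \o u) ->
  (fun n => \int[mu]_(x in E n) u x) @ \oo --> \int[mu]_(x in D) u x.
Proof.
move=> mD mE ED DE iu.
have mu' : measurable_fun D u.
  by apply/measurable_EFinP; exact: measurable_int iu.
rewrite (_ : (fun n => _) = fun n => \int[mu]_(x in D) (u \_ (E n)) x); last first.
  by apply/funext => n; rewrite -Rintegral_mkcondr setIidr.
apply: (cvg_Rintegral_dominated (v := fun x => `|u x|)) => //.
- move=> n; apply/measurable_restrict => //; first exact: mE.
  exact: measurable_funS mu'.
- move=> x Dx; apply: cvg_near_cst.
  by near=> n; rewrite patchE mem_set//; near: n; exact: DE.
- exact: integrable_norm.
- move=> n x Dx; rewrite patchE.
  by case: ifPn => // _; rewrite normr0.
Unshelve. all: by end_near. Qed.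

Lemma ccvg_cintegral_exhaust D (E : nat -> set R) f :
  measurable D -> (forall n, measurable (E n)) -> (forall n, E n `<=` D) ->
  (forall x, D x -> \forall n \near \oo, E n x) ->
  cintegrable D f -> ccvg (fun n => cintegral (E n) f) (cintegral D f).
Proof.
by move=> mD mE ED DE [fr fi]; split; exact: cvg_Rintegral_exhaust.
Qed.

End ComplexIntegral.

(** * The Mellin kernel *)

Section MellinKernel.
Variable R : realType.
Local Notation mu := (@lebesgue_measure R).
Local Notation RT := (measurableTypeR R).
Implicit Types (f : R -> R) (x : R) (s : R[i]) (D : set RT).

Definition mellin_kernel f s x : R[i] := (f x)%:C * cpow x (- 1 - s).

Lemma Re_mellin_kernel f s x :
  complex.Re (mellin_kernel f s x) = f x * complex.Re (cpow x (- 1 - s)).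
Proof. by rewrite cReM mul0r subr0. Qed.

Lemma Im_mellin_kernel f s x :
  complex.Im (mellin_kernel f s x) = f x * complex.Im (cpow x (- 1 - s)).
Proof. by rewrite cImM mul0r addr0. Qed.

Lemma measurable_Re_mellin_kernel f s D : measurable_fun [set: R] f ->
  measurable_fun D (fun x => complex.Re (mellin_kernel f s x)).
Proof.
move=> mf; under eq_fun do rewrite Re_mellin_kernel; apply: measurable_funTS.
by apply: measurable_funM => //; exact: measurable_Re_cpow.
Qed.

Lemma measurable_Im_mellin_kernel f s D : measurable_fun [set: R] f ->
  measurable_fun D (fun x => complex.Im (mellin_kernel f s x)).
Proof.
move=> mf; under eq_fun do rewrite Im_mellin_kernel; apply: measurable_funTS.
by apply: measurable_funM => //; exact: measurable_Im_cpow.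
Qed.

Lemma normr_Re_mellin_kernel f s x : 0 <= f x ->
  `|complex.Re (mellin_kernel f s x)| <= f x * x `^ (- 1 - complex.Re s).
Proof.
move=> f0; rewrite Re_mellin_kernel normrM ger0_norm// ler_wpM2l//.
by rewrite (le_trans (normr_Re_cpow _ _))// !cpartE.
Qed.

Lemma normr_Im_mellin_kernel f s x : 0 <= f x ->
  `|complex.Im (mellin_kernel f s x)| <= f x * x `^ (- 1 - complex.Re s).
Proof.
move=> f0; rewrite Im_mellin_kernel normrM ger0_norm// ler_wpM2l//.
by rewrite (le_trans (normr_Im_cpow _ _))// !cpartE.
Qed.

Lemma cintegrable_mellin_kernel D f s : measurable D ->
  measurable_fun [set: R] f -> (forall x, 0 <= f x) ->
  mu.-integrable D (EFin \o (fun x => f x * x `^ (- 1 - complex.Re s))) ->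
  cintegrable D (mellin_kernel f s).
Proof.
move=> mD mf f0 fi; apply: (cintegrable_dominated mD _ _ fi).
- exact: measurable_Re_mellin_kernel.
- exact: measurable_Im_mellin_kernel.
- by move=> x _; exact: normr_Re_mellin_kernel.
- by move=> x _; exact: normr_Im_mellin_kernel.
Qed.

End MellinKernel.

(** * Integrals of powers *)

Section PowerIntegrals.
Variable R : realType.
Local Notation mu := (@lebesgue_measure R).
Local Notation RT := (measurableTypeR R).
Implicit Types (x a b : R) (z s : R[i]).

Lemma is_derive_cos_ln q x : 0 < x ->
  is_derive x 1 (fun y => cos (q * ln y)) (- sin (q * ln x) * (q / x)).
Proof.
move=> x0.
have h := is_derive1_ln x0.
have h1 : is_derive x 1 (fun y => q * ln y) (q / x) by apply: is_deriveZ.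
exact: (is_derive1_comp (is_derive_cos _) h1).
Qed.

Lemma is_derive_sin_ln q x : 0 < x ->
  is_derive x 1 (fun y => sin (q * ln y)) (cos (q * ln x) * (q / x)).
Proof.
move=> x0.
have h := is_derive1_ln x0.
have h1 : is_derive x 1 (fun y => q * ln y) (q / x) by apply: is_deriveZ.
exact: (is_derive1_comp (is_derive_sin _) h1).
Qed.

Lemma powR_div p x : 0 < x -> x `^ p / x = x `^ (p - 1).
Proof. by move=> x0; rewrite powRB ?(gt_eqF x0) ?implybT// powRr1 ?ltW. Qed.

Lemma is_derive_Re_cpow z x : 0 < x ->
  is_derive x 1 (fun y => complex.Re (cpow y z))
    (complex.Re (z * cpow x (z - 1))).
Proof.
move=> x0.
have h1 := is_derive1_powR (complex.Re z) x0.
have h2 := is_derive_cos_ln (complex.Im z) x0.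
apply: (is_derive_eq (is_deriveM h1 h2)).
rewrite !cpartE /= !cpartE /= subr0 /GRing.scale /= -powR_div//; field.
by rewrite gt_eqF.
Qed.

Lemma is_derive_Im_cpow z x : 0 < x ->
  is_derive x 1 (fun y => complex.Im (cpow y z))
    (complex.Im (z * cpow x (z - 1))).
Proof.
move=> x0.
have h1 := is_derive1_powR (complex.Re z) x0.
have h2 := is_derive_sin_ln (complex.Im z) x0.
apply: (is_derive_eq (is_deriveM h1 h2)).
rewrite !cpartE /= !cpartE /= subr0 /GRing.scale /= -powR_div//; field.
by rewrite gt_eqF.
Qed.

Lemma continuous_Re_cpow z x : 0 < x ->
  {for x, continuous (fun y => complex.Re (cpow y z))}.
Proof.
move=> x0; apply/differentiable_continuous/derivable1_diffP.
by have [] := is_derive_Re_cpow z x0.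
Qed.

Lemma continuous_Im_cpow z x : 0 < x ->
  {for x, continuous (fun y => complex.Im (cpow y z))}.
Proof.
move=> x0; apply/differentiable_continuous/derivable1_diffP.
by have [] := is_derive_Im_cpow z x0.
Qed.

(** All primitives below are smooth on the whole half-line, so hypotheses at
    every positive point are easier to supply than the ones at the ends of
    [[a, b]]. *)
Lemma FTC2_gt0 (f F : R -> R) a b : 0 < a -> a < b ->
  (forall x, 0 < x -> is_derive x 1 F (f x)) ->
  (forall x, 0 < x -> {for x, continuous f}) ->
  mu.-integrable `[a, b] (EFin \o f) /\
  \int[mu]_(x in `[a, b]) f x = F b - F a.
Proof.
move=> a0 ab dF cf.
have cF x : 0 < x -> {for x, continuous F}.
  by move=> x0; apply/differentiable_continuous/derivable1_diffP; have [] := dF _ x0.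
have wf : {within `[a, b], continuous f}.
  apply: continuous_in_subspaceT => x /[!inE]/=.
  by rewrite in_itv/= => /andP[ax _]; apply: cf; exact: lt_le_trans ax.
split; first by apply: continuous_compact_integrable => //; exact: segment_compact.
rewrite /Rintegral (continuous_FTC2 ab wf (F := F))//.
- split.
  + move=> x; rewrite in_itv/= => /andP[ax _].
    by have [] := dF _ (lt_trans a0 ax).
  + by apply: cvg_at_right_filter; exact: cF.
  + by apply: cvg_at_left_filter; apply: cF; exact: lt_trans ab.
- move=> x; rewrite in_itv/= => /andP[ax _].
  by rewrite derive1E; have [] := dF _ (lt_trans a0 ax).
Qed.

Lemma cintegral_cpow a b z : 0 < a -> a <= b -> z != 0 ->
  cintegrable `[a, b] (fun x => cpow x (z - 1)) /\
  cintegral `[a, b] (fun x => cpow x (z - 1)) = (cpow b z - cpow a z) / z.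
Proof.
move=> a0; rewrite le_eqVlt => /predU1P[<- _|ab z0].
  rewrite set_itv1 subrr mul0r; split.
    split; apply: null_set_integrable => //; try exact: lebesgue_measure_set1.
      apply/measurable_EFinP; exact: measurable_funS (measurable_Re_cpow _).
    apply/measurable_EFinP; exact: measurable_funS (measurable_Im_cpow _).
  by apply: complex_eqP; rewrite /= Rintegral_set1.
have cRe x : 0 < x -> {for x, continuous (fun y => complex.Re (z * cpow y (z - 1)))}.
  move=> x0; rewrite (_ : (fun y => _) = (fun y : R =>
      complex.Re z * complex.Re (cpow y (z - 1)) -
      complex.Im z * complex.Im (cpow y (z - 1)))); last first.
    by apply/funext => y; rewrite cReM.
  apply: continuousB; apply: continuousM; try exact: cst_continuous.
    exact: continuous_Re_cpow.
  exact: continuous_Im_cpow.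
have cIm x : 0 < x -> {for x, continuous (fun y => complex.Im (z * cpow y (z - 1)))}.
  move=> x0; rewrite (_ : (fun y => _) = (fun y : R =>
      complex.Re z * complex.Im (cpow y (z - 1)) +
      complex.Im z * complex.Re (cpow y (z - 1)))); last first.
    by apply/funext => y; rewrite cImM.
  apply: continuousD; apply: continuousM; try exact: cst_continuous.
    exact: continuous_Im_cpow.
  exact: continuous_Re_cpow.
have [ir er] := FTC2_gt0 a0 ab (is_derive_Re_cpow z) cRe.
have [ii ei] := FTC2_gt0 a0 ab (is_derive_Im_cpow z) cIm.
have i1 : cintegrable `[a, b] (fun x => z * cpow x (z - 1)) by [].
have i2 : cintegrable `[a, b] (fun x => cpow x (z - 1)).
  apply: (eq_cintegrable _ _ (cintegrableZl z^-1 _ i1)) => // x _.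
  by rewrite mulKf.
split => //; apply/(mulfI z0); rewrite -cintegralZl// mulrCA divff// mulr1.
by apply: complex_eqP; rewrite !cpartE /= ?er ?ei.
Qed.

(** Monotone convergence: uniformly bounded integrals over an exhaustion. This
    gives integrability at [0] and at [+oo] from integrals over compact
    intervals. *)
Lemma integrable_exhaust (D : set RT) (E : nat -> set RT) (f : R -> R) (M : R) :
  measurable D -> (forall n, measurable (E n)) -> nondecreasing_seq E ->
  D = \bigcup_n E n -> measurable_fun D f -> (forall x, D x -> 0 <= f x) ->
  (forall n, mu.-integrable (E n) (EFin \o f)) ->
  (forall n, \int[mu]_(x in E n) f x <= M) ->
  mu.-integrable D (EFin \o f).
Proof.
move=> mD mE ndE DE mf f0 iE IE.
have ED n : E n `<=` D by rewrite DE; exact: bigcup_sup.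
apply/integrableP; split; first exact/measurable_EFinP.
rewrite (@eq_integral _ _ _ mu D (EFin \o f)); last first.
  by move=> x /[!inE] Dx /=; rewrite ger0_norm ?f0.
rewrite [in ltLHS]DE; apply: (@le_lt_trans _ _ M%:E); last exact: ltry.
have : (\int[mu]_(x in E n) (EFin \o f) x)%E @[n --> \oo] -->
    (\int[mu]_(x in \bigcup_n E n) (EFin \o f) x)%E.
  apply: ge0_nondecreasing_set_cvg_integral => //.
  - by move=> n; apply: measurable_funS (ED n) _ => //; exact/measurable_EFinP.
  - by move=> n x /ED Dx; rewrite lee_fin f0.
move=> /cvge_to_le; apply; apply: nearW => n.
by rewrite -[leLHS]fineK ?lee_fin ?IE//; exact: integrable_fin_num.
Qed.

Lemma Rintegral_powR a b p : 0 < a -> a <= b -> p != 0 ->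
  mu.-integrable `[a, b] (EFin \o (fun x => x `^ (p - 1))) /\
  \int[mu]_(x in `[a, b]) (x `^ (p - 1)) = (b `^ p - a `^ p) / p.
Proof.
move=> a0 ab p0.
have p0' : p%:C != 0 by rewrite eq_complex /= negb_and p0.
have E x q : complex.Re (cpow x q%:C) = x `^ q by rewrite /= mul0r cos0 mulr1.
have [[ir _] ei] := cintegral_cpow a0 ab p0'.
have E1 x : complex.Re (cpow x (p%:C - 1)) = x `^ (p - 1).
  by rewrite (_ : p%:C - 1 = (p - 1)%:C) ?E// rmorphB.
split; first by apply: eq_integrable_fin ir => // x _; rewrite E1.
under eq_Rintegral do rewrite -E1.
move/(congr1 (@complex.Re R)) : ei; rewrite [LHS]/= => ->.
by rewrite -fmorphV cReM !cpartE !E /= mul0r sin0 !mulr0 subr0.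
Qed.

Lemma integrable_powR_cy p : 0 < p ->
  mu.-integrable `[1, +oo[ (EFin \o (fun x => x `^ (- 1 - p))).
Proof.
move=> p0.
have np0 : - p != 0 by rewrite oppr_eq0 gt_eqF.
have h n : (1 : R) <= n.+1%:R by rewrite ler1n.
have E : - p - 1 = - 1 - p by rewrite addrC.
apply: (@integrable_exhaust _ (fun n => `[1, n.+1%:R]%classic) _ p^-1) => //.
- move=> m n mn; rewrite subsetEset; apply: subset_itvl.
  by rewrite bnd_simp ler_nat.
- apply/seteqP; split => x /=; rewrite in_itv /= ?andbT.
    move=> x1; exists (Num.trunc x) => //=.
    by rewrite in_itv /= x1 ltW// truncnS_gt.
  by move=> [n _ /=]; rewrite in_itv /= => /andP[].
- exact: measurable_funS (measurable_powR _).
- by move=> x _; exact: powR_ge0.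
- by move=> n; have [] := Rintegral_powR ltr01 (h n) np0; rewrite E.
- move=> n; have [_] := Rintegral_powR ltr01 (h n) np0; rewrite E => ->.
  rewrite powR1 invrN mulrN -mulNr opprB ler_pdivrMr// mulVf ?gt_eqF//.
Qed.

Lemma integrable_powR_0c p : 0 < p ->
  mu.-integrable `]0, 1] (EFin \o (fun x => x `^ (p - 1))).
Proof.
move=> p0.
have np0 : p != 0 by rewrite gt_eqF.
have h n : 0 < n.+1%:R^-1 :> R by rewrite invr_gt0.
have h1 n : n.+1%:R^-1 <= 1 :> R by rewrite invf_le1// ler1n.
apply: (@integrable_exhaust _ (fun n => `[n.+1%:R^-1, 1]%classic) _ p^-1) => //.
- move=> m n mn; rewrite subsetEset; apply: subset_itvr.
  by rewrite bnd_simp lef_pV2 ?posrE// ler_nat.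
- apply/seteqP; split => x /=; rewrite in_itv /=.
    move=> /andP[x0 x1]; exists (Num.trunc x^-1) => //=.
    rewrite in_itv /= x1 andbT -[leRHS]invrK lef_pV2 ?posrE ?invr_gt0//.
    by rewrite ltW// truncnS_gt.
  move=> [n _ /=]; rewrite in_itv /= => /andP[nx ->].
  by rewrite (lt_le_trans _ nx).
- exact: measurable_funS (measurable_powR _).
- by move=> x _; exact: powR_ge0.
- by move=> n; have [] := Rintegral_powR (h n) (h1 n) np0.
- move=> n; have [_ ->] := Rintegral_powR (h n) (h1 n) np0.
  rewrite powR1 ler_pdivrMr// mulVf ?gt_eqF//.
Qed.

End PowerIntegrals.

(** * The Mellin integral of the fractional part and the Dirichlet series *)

Section FractPart.
Variable R : realType.
Local Notation fract_kernel := (mellin_kernel (@fract_part R)).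
Local Notation mu := (@lebesgue_measure R).
Local Notation RT := (measurableTypeR R).
Implicit Types (x : R) (s z : R[i]).

Lemma fract_part_ge0 x : 0 <= fract_part x.
Proof. by rewrite subr_ge0 floor_le. Qed.

Lemma fract_part_lt1 x : fract_part x < 1.
Proof. by have /andP[_] := floor_itv x; rewrite intrD1 ltrBlDr addrC. Qed.

Lemma fract_partE x n : n%:R <= x -> x < n.+1%:R -> fract_part x = x - n%:R.
Proof.
move=> nx xn; rewrite /fract_part (_ : Num.floor x = n%:Z)//.
by apply/floor_def; rewrite intrD1 -pmulrn natr1 nx xn.
Qed.

Lemma measurable_fract_part : measurable_fun [set: R] (@fract_part R).
Proof.
apply: measurable_funB => //.
apply: nondecreasing_measurable => // x y xy.
by rewrite ler_int le_floor.
Qed.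

Lemma integrable_fract_powR_cy p : 0 < p ->
  mu.-integrable `[1, +oo[ (EFin \o (fun x => fract_part x * x `^ (- 1 - p))).
Proof.
move=> p0; apply: (integrable_dominated _ _ (integrable_powR_cy p0)) => //.
  apply: measurable_funTS; apply: measurable_funM; first exact: measurable_fract_part.
  exact: measurable_powR.
move=> x _; rewrite ger0_norm ?mulr_ge0 ?powR_ge0 ?fract_part_ge0//.
by rewrite ler_piMl ?powR_ge0// ltW// fract_part_lt1.
Qed.

(** Near [0] the fractional part is [x] and leaves [x^(-p)], integrable since
    [p < 1]; near [+oo] it is bounded and leaves [x^(-1-p)], integrable since
    [0 < p]. *)
Lemma integrable_fract_powR_oy p : 0 < p -> p < 1 ->
  mu.-integrable `]0, +oo[ (EFin \o (fun x => fract_part x * x `^ (- 1 - p))).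
Proof.
move=> p0 p1.
pose h1 := (fun x : RT => x `^ (1 - p - 1)) \_ `]0, 1].
pose h2 := (fun x : RT => x `^ (- 1 - p)) \_ `[1, +oo[.
have i1 : mu.-integrable `]0, +oo[ (EFin \o h1).
  rewrite /h1 -restrict_EFin; apply/integrable_restrict => //.
  apply: integrableS (integrable_powR_0c _) => //; last by rewrite subr_gt0.
  exact: measurableI.
have i2 : mu.-integrable `]0, +oo[ (EFin \o h2).
  rewrite /h2 -restrict_EFin; apply/integrable_restrict => //.
  apply: integrableS (integrable_powR_cy p0) => //.
  exact: measurableI.
apply: (integrable_dominated _ _ (integrable_finD _ i1 i2)) => //.
  apply: measurable_funTS; apply: measurable_funM; first exact: measurable_fract_part.
  exact: measurable_powR.
move=> x /=; rewrite in_itv/= andbT => x0.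
rewrite ger0_norm ?mulr_ge0 ?powR_ge0 ?fract_part_ge0//.
have [x1|x1] := ltP x 1.
  rewrite (@fract_partE x 0 (ltW x0) x1) subr0 -{1}(powRr1 (ltW x0)) -powRD; last first.
    by rewrite (gt_eqF x0) implybT.
  rewrite /h1 patchE mem_set /=; last by rewrite in_itv/= x0 ltW.
  rewrite (_ : 1 + (- 1 - p) = 1 - p - 1); last by ring.
  rewrite lerDl /h2 patchE; case: ifPn => // _; exact: powR_ge0.
rewrite /h2 patchE mem_set /=; last by rewrite in_itv/= x1.
rewrite ler_wpDl//; last by rewrite ler_piMl ?powR_ge0// ltW// fract_part_lt1.
by rewrite /h1 patchE; case: ifPn => // _; exact: powR_ge0.
Qed.

Lemma cintegrable_fract_kernel_cy s : 0 < complex.Re s ->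
  cintegrable `[1, +oo[ (fract_kernel s).
Proof.
move=> s0; apply: cintegrable_mellin_kernel => //.
- exact: measurable_fract_part.
- exact: fract_part_ge0.
- exact: integrable_fract_powR_cy.
Qed.

Lemma cintegrable_fract_kernel s : 0 < complex.Re s -> complex.Re s < 1 ->
  cintegrable `]0, +oo[ (fract_kernel s).
Proof.
move=> s0 s1; apply: cintegrable_mellin_kernel => //.
- exact: measurable_fract_part.
- exact: fract_part_ge0.
- exact: integrable_fract_powR_oy.
Qed.

Lemma cvg_powR_pinfty p : 0 < p -> (fun n => n.+1%:R `^ (- p) : R) @ \oo --> (0 : R).
Proof.
move=> p0.
rewrite (_ : (fun n => _) = (powR (R:=R))^~ p \o (fun n => n.+1%:R^-1)); last first.
  by apply/funext => n /=; rewrite -powR_inv1// -powRrM mulN1r.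
apply: (cvg_comp _ _ _ (powR_cvg0 p0)) => A /=.
rewrite /at_right /within /= => -[e /= e0 eA].
have [N _ hN] : \forall n \near \oo, `|0 - n.+1%:R^-1 : R| < e.
  by have /cvgrPdist_lt /(_ _ e0) := @cvg_harmonic R.
by exists N => // n /hN h; apply: eA => //; rewrite /= invr_gt0.
Qed.

Lemma ccvg_cpow_pinfty z : complex.Re z < 0 -> ccvg (fun n => cpow n.+1%:R z) 0.
Proof.
move=> z0; have p0 : 0 < - complex.Re z by rewrite oppr_gt0.
have := cvg_powR_pinfty p0; rewrite opprK => h.
split; apply: norm_cvg0.
- apply: (squeeze_cvgr _ _ h); [|exact: cvg_cst].
  by apply: nearW => n; rewrite normr_ge0 normr_Re_cpow.
- apply: (squeeze_cvgr _ _ h); [|exact: cvg_cst].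
  by apply: nearW => n; rewrite normr_ge0 normr_Im_cpow.
Qed.

(** The exponents are written in the form [z - 1] under which
    [cintegral_cpow] integrates a power. *)
Lemma fract_kernelE s x n : 0 < x -> n%:R <= x -> x < n.+1%:R ->
  fract_kernel s x = cpow x (1 - s - 1) + (- n%:R) * cpow x (- s - 1).
Proof.
move=> x0 nx xn; rewrite /mellin_kernel (fract_partE nx xn) rmorphB rmorph_nat mulrBl mulNr.
congr (_ - _ * cpow x _); last by ring.
by rewrite -[LHS]/(x%:C * _) -(cpow1r x0) -cpowD//; congr cpow; ring.
Qed.

Lemma cintegral_fract_kernel_0c s : 0 < complex.Re s -> complex.Re s < 1 ->
  cintegral `]0, 1[ (fract_kernel s) = (1 - s)^-1.
Proof.
move=> s0 s1.
have ns1 : 1 - s != 0 by rewrite subr1_neq0// lt_eqF.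
have h n : 0 < n.+1%:R^-1 :> R by rewrite invr_gt0.
have h1 n : n.+1%:R^-1 <= 1 :> R by rewrite invf_le1// ler1n.
have ik : cintegrable `]0, 1[ (fract_kernel s).
  apply: cintegrableS (cintegrable_fract_kernel s0 s1) => //.
  by apply: subset_itvl.
have := @ccvg_cintegral_exhaust R `]0, 1[ (fun n => `[n.+1%:R^-1, 1[%classic) _ _ _ _ _ ik.
have -> : (fun n => cintegral `[n.+1%:R^-1, 1[ (fract_kernel s)) =
    (fun n => (1 - s)^-1 * (1 + (- 1) * cpow n.+1%:R (- (1 - s)))).
  apply/funext => n.
  have [i e] := cintegral_cpow (h n) (h1 n) ns1.
  rewrite (@eq_cintegral _ _ (fun x => cpow x (1 - s - 1))); last first.
    move=> x /=; rewrite in_itv/= => /andP[nx x1].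
    have x0 := lt_le_trans (h n) nx.
    by rewrite (@fract_kernelE s x 0)// ?ltW// oppr0 mul0r addr0.
  rewrite cintegral_bndo_bndc; last first.
    by apply: cintegrableS i => //; apply: subset_itvl; rewrite bnd_simp.
  rewrite e cpow1l mulrC mulN1r; congr (_ * (_ - _)).
  apply: complex_eqP; rewrite /= !cpartE /= lnV ?posrE// -powR_inv1// -powRrM mulN1r opprB.
    by rewrite mulrN mulNr.
  by rewrite mulrN mulNr.
move=> h2; apply: ccvg_unique (h2 _ _ _ _) _ => //.
- by move=> n; apply: subset_itvr; rewrite bnd_simp.
- move=> x /=; rewrite in_itv/= => /andP[x0 x1].
  exists (Num.trunc x^-1) => // n /= xn; rewrite in_itv /= x1 andbT.
  rewrite -[leRHS]invrK lef_pV2 ?posrE ?invr_gt0//.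
  by rewrite (le_trans (ltW (truncnS_gt _)))// ler_nat.
- rewrite -[X in ccvg _ X]mulr1; apply: ccvgZ.
  rewrite -[X in ccvg _ X]addr0; apply: ccvgD; first exact: ccvg_cst.
  rewrite -[X in ccvg _ X](mulr0 (- 1)); apply: ccvgZ; apply: ccvg_cpow_pinfty.
  by rewrite !cpartE /= oppr_lt0 subr_gt0.
Qed.

(** The differences of [cpow _ (1 - s)] telescope when such pieces are added,
    and what remains are the terms of the Dirichlet series. *)
Lemma cintegral_fract_kernel_piece s n : s != 0 -> 1 - s != 0 ->
  cintegrable `[n.+1%:R, n.+2%:R[ (fract_kernel s) /\
  s * cintegral `[n.+1%:R, n.+2%:R[ (fract_kernel s) =
  (cpow n.+2%:R (1 - s) - cpow n.+1%:R (1 - s)) / (1 - s) - cpow n.+2%:R (- s).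
Proof.
move=> s0 s1.
have h : 0 < n.+1%:R :> R by rewrite ltr0n.
have h' : 0 < n.+2%:R :> R by rewrite ltr0n.
have h1 : n.+1%:R <= n.+2%:R :> R by rewrite ler_nat.
have s0' : - s != 0 by rewrite oppr_eq0.
have [i1 e1] := cintegral_cpow h h1 s1.
have [i2 e2] := cintegral_cpow h h1 s0'.
have i : cintegrable `[n.+1%:R, n.+2%:R]
    (fun x => cpow x (1 - s - 1) + (- n.+1%:R) * cpow x (- s - 1)).
  by apply: cintegrableD => //; exact: cintegrableZl.
have i' : cintegrable `[n.+1%:R, n.+2%:R[
    (fun x => cpow x (1 - s - 1) + (- n.+1%:R) * cpow x (- s - 1)).
  by apply: cintegrableS i => //; apply: subset_itvl; rewrite bnd_simp.
have E x : x \in `[n.+1%:R, n.+2%:R[ -> fract_kernel s x =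
    cpow x (1 - s - 1) + (- n.+1%:R) * cpow x (- s - 1).
  by rewrite in_itv/= => /andP[nx xn]; rewrite (fract_kernelE _ _ nx xn)// (lt_le_trans h).
split; first exact: eq_cintegrable i'.
rewrite (eq_cintegral E) cintegral_bndo_bndc// cintegralD//; last exact: cintegrableZl.
rewrite cintegralZl// e1 e2.
have P x : 0 < x -> cpow x (1 - s) = x%:C * cpow x (- s).
  by move=> x0; rewrite cpowD// cpow1r.
rewrite !P// !rmorph_nat -[n.+2]addn1 natrD; field.
by rewrite s0 s1.
Qed.

Lemma cintegral_fract_kernel_partial s n : 0 < complex.Re s -> 1 - s != 0 ->
  s * cintegral `[1, n.+1%:R[ (fract_kernel s) =
  (cpow n.+1%:R (1 - s) - 1) / (1 - s) + 1 -
  series (fun k => cpow k.+1%:R (- s)) n.+1.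
Proof.
move=> s0 s1.
have sn0 : s != 0 by apply: contraTneq s0 => ->; rewrite ltxx.
elim: n => [|n IH].
  rewrite /series /= big_nat1 !cpow1l subrr mul0r add0r subrr.
  rewrite set_itvco0 (_ : cintegral _ _ = 0) ?mulr0//.
  by apply: complex_eqP; rewrite /= Rintegral_set0.
have [i e] := cintegral_fract_kernel_piece n sn0 s1.
have U : `[1, n.+2%:R[%classic = `[1, n.+1%:R[ `|` `[n.+1%:R, n.+2%:R[ :> set R.
  by apply: itv_bndbnd_setU; rewrite bnd_simp ?ler1n ?ler_nat.
rewrite U cintegral_setU//.
- rewrite mulrDr IH e /series /= [in RHS]big_nat_recr//=; field.
  exact: s1.
- apply/disj_setPS => x [] /=; rewrite !in_itv/= => /andP[_ xn] /andP[nx _].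
  by move: (lt_le_trans xn nx); rewrite ltxx.
- rewrite -U; apply: cintegrableS (cintegrable_fract_kernel_cy s0) => //.
  by apply: subset_itvl.
Qed.

(** The limit of [cintegral_fract_kernel_partial]: the boundary term
    [n^(1-s)] tends to [0] as [1 < Re s], while the integral on the right still
    converges for [0 < Re s]; this is what allows the continuation to the
    strip. *)
Lemma zeta_mellin_cy (zeta : R[i] -> R[i]) s : is_riemann_zeta zeta ->
  1 < complex.Re s ->
  zeta s = 1 - (1 - s)^-1 - s * cintegral `[1, +oo[ (fract_kernel s).
Proof.
move=> [dz _] s1; have s0 : 0 < complex.Re s by exact: lt_trans s1.
have ns1 : 1 - s != 0 by rewrite subr1_neq0// gt_eqF.
have ik := cintegrable_fract_kernel_cy s0.
have c1 := cvg_ccvg (dz _ s1).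
have c2 : ccvg (fun n => cintegral `[1, n.+1%:R[ (fract_kernel s))
    (cintegral `[1, +oo[ (fract_kernel s)).
  apply: ccvg_cintegral_exhaust => //.
  - by move=> n; apply: subset_itvl.
  - move=> x /=; rewrite in_itv/= andbT => x1.
    exists (Num.trunc x) => // n /= xn; rewrite in_itv /= x1 /=.
    by rewrite (lt_le_trans (truncnS_gt _))// ler_nat.
have c3 : ccvg (fun n => (1 - s)^-1 * (cpow n.+1%:R (1 - s) + (- 1)) + 1 +
     (- s) * cintegral `[1, n.+1%:R[ (fract_kernel s))
   ((1 - s)^-1 * (0 + - 1) + 1 + (- s) * cintegral `[1, +oo[ (fract_kernel s)).
  apply: ccvgD; last exact: ccvgZ.
  apply: ccvgD; last exact: ccvg_cst.
  apply: ccvgZ; apply: ccvgD; last exact: ccvg_cst.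
  by apply: ccvg_cpow_pinfty; rewrite !cpartE /= subr_lt0.
have E : (fun n => series (fun k => cpow k.+1%:R (- s)) n.+1) =
    (fun n => (1 - s)^-1 * (cpow n.+1%:R (1 - s) + (- 1)) + 1 +
     (- s) * cintegral `[1, n.+1%:R[ (fract_kernel s)).
  apply/funext => n; rewrite mulNr cintegral_fract_kernel_partial//; ring.
rewrite (_ : 1 - _ - _ = (1 - s)^-1 * (0 + - 1) + 1 +
  (- s) * cintegral `[1, +oo[ (fract_kernel s)); last by ring.
apply: (ccvg_unique _ c3); rewrite -E.
by case: c1 => cr ci; split; [rewrite -(cvg_shiftS (fun n => complex.Re _)) in cr
  |rewrite -(cvg_shiftS (fun n => complex.Im _)) in ci].
Qed.

End FractPart.

(** * Functions of a real variable with local power series *)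

Section LocalSeries.
Variable R : realType.
Implicit Types (f g : R -> R) (x r h : R) (a : nat -> R).

Definition locally_series f x0 : Prop :=
  exists a : nat -> R, \forall x \near x0,
    series (fun k => a k * (x - x0) ^+ k) @ \oo --> f x.

(** The terms at [r] are bounded, hence at [|h| <= r / 2] the tail is dominated
    by a geometric series of ratio [1 / 2]; the bound is uniform in the number
    of terms, so it passes to the limit. *)
Lemma power_series_near0 a r : 0 < r -> cvgn (series (fun k => a k * r ^+ k)) ->
  exists K, forall h n, `|h| <= r / 2 ->
    `|series (fun k => a k * h ^+ k) n.+1 - a 0%N| <= K * `|h|.
Proof.
move=> r0 /cvg_series_cvg_0 ar0.
have [M [_ /(_ (M + 1))]] := cvg_seq_bounded (cvgP _ ar0).
rewrite ltrDl ltr01 => /(_ isT); set B := M + 1 => /= aB.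
have {}aB k : `|a k * r ^+ k| <= B by exact: aB.
exists (2 * (B / r)) => h n hr.
have B0 : 0 <= B by exact: le_trans (aB 0%N).
have step : forall k, `|a k.+1 * h ^+ k.+1| <= B / r * `|h| * 2^-1 ^+ k.
  move=> k.
  have -> : `|a k.+1 * h ^+ k.+1| = `|a k.+1 * r ^+ k.+1| / r * `|h| * (`|h| / r) ^+ k.
    rewrite !normrM !normrX (ger0_norm (ltW r0)) !exprS expr_div_n; field.
    by rewrite expf_neq0 gt_eqF.
  have ir0 : 0 <= r^-1 by rewrite invr_ge0 ltW.
  apply: ler_pM; rewrite ?mulr_ge0 ?exprn_ge0 ?divr_ge0 ?(ltW r0)//.
    by rewrite ler_wpM2r// ler_wpM2r.
  by rewrite lerXn2r ?nnegrE ?divr_ge0 ?(ltW r0)// ler_pdivrMr// mulrC.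
suff : `|series (fun k => a k * h ^+ k) n.+1 - a 0%N| <=
    B / r * `|h| * (2 - 2 * 2^-1 ^+ n).
  move=> /le_trans; apply; rewrite [leRHS](_ : _ = B / r * `|h| * 2); last by ring.
  have ir0 : 0 <= r^-1 by rewrite invr_ge0 ltW.
  by rewrite ler_wpM2l ?mulr_ge0// gerBl mulr_ge0// exprn_ge0.
elim: n => [|n IH].
  by rewrite /series /= big_nat1 expr0 mulr1 subrr normr0 expr0 mulr1 subrr mulr0.
rewrite /series /= big_nat_recr//= addrAC.
apply: (le_trans (ler_normD _ _)); apply: (le_trans (lerD IH (step n))).
by rewrite -mulrDr exprS le_eqVlt; apply/orP; left; apply/eqP; congr (_ * _); field.
Qed.

(** The constant coefficient is the limit of the sum at [0], by
    [power_series_near0]; once it is known to vanish, dividing by [h] shifts the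
    coefficients and the argument is repeated.  Vanishing on one side of [0] is
    enough. *)
Lemma power_series_coef0 a r : 0 < r ->
  (forall h, 0 < h -> h <= r -> series (fun k => a k * h ^+ k) @ \oo --> (0 : R)) ->
  forall k, a k = 0.
Proof.
move=> r0 + k; have a00 b : (forall h, 0 < h -> h <= r ->
    series (fun k => b k * h ^+ k) @ \oo --> (0 : R)) -> b 0%N = 0.
  move=> ha; have [K hK] := power_series_near0 r0 (cvgP _ (ha _ r0 (lexx _))).
  have key h : 0 < h -> h <= r / 2 -> `|b 0%N| <= K * h.
    move=> h0 hr; have hr' : h <= r.
      by rewrite (le_trans hr)// ler_pdivrMr// mulrDr mulr1 lerDl ltW.
    have c : (fun n => `|series (fun k => b k * h ^+ k) n.+1 - b 0%N|) @ \oo --> `|0 - b 0%N|.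
      apply: cvg_norm; apply: cvgB; last exact: cvg_cst.
      by have := ha _ h0 hr'; rewrite -(cvg_shiftS (series _)).
    rewrite -normrN -[- _]add0r; apply: (cvgr_to_le c); apply: nearW => n.
    by rewrite -{2}(gtr0_norm h0); apply: hK; rewrite gtr0_norm.
  apply/eqP; rewrite -normr_le0; apply/ler_addgt0Pl => e e0; rewrite addr0.
  (* [|K| + 1] rather than [K], whose sign is unknown *)
  pose h := Num.min (r / 2) (e / (`|K| + 1)).
  have K1 : 0 < `|K| + 1 by rewrite ltr_wpDl.
  have h0 : 0 < h by rewrite lt_min !divr_gt0.
  apply: (le_trans (key h h0 _)); first by rewrite ge_min lexx.
  apply: (@le_trans _ _ ((`|K| + 1) * h)).
    by rewrite ler_wpM2r ?(ltW h0)// (le_trans (ler_norm _))// lerDl.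
  by rewrite mulrC -ler_pdivlMr// ge_min lexx orbT.
elim: k a => [|k IH] a ha; first exact: a00 ha.
apply: (IH (fun k => a k.+1)) => h h0 hr.
have := ha _ h0 hr; rewrite -(cvg_shiftS (series _)) => c.
rewrite (_ : series _ = fun n => h^-1 * (series (fun k => a k * h ^+ k) n.+1)); last first.
  apply/funext => n; rewrite /series /= big_nat_recl//= (a00 _ ha) mul0r add0r mulr_sumr.
  apply: eq_bigr => i _; rewrite exprS; field.
  by rewrite gt_eqF.
by rewrite -[X in _ --> X](mulr0 h^-1); apply: cvgMr.
Qed.

End LocalSeries.

Section LocalSeriesClosure.
Variable R : realType.
Implicit Types (f g : R -> R) (x c : R).

Lemma locally_series_cst c x0 : locally_series (fun=> c) x0.
Proof.
exists (fun k => if k == 0%N then c else 0); near=> x.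
rewrite -(cvg_shiftS (series _)).
rewrite (_ : (fun n => _) = cst c); first exact: cvg_cst.
apply/funext => n; rewrite /series /= big_nat_recl//= expr0 mulr1.
by rewrite big1 ?addr0// => i _; rewrite mul0r.
Unshelve. all: by end_near. Qed.

Lemma locally_seriesD f g x0 : locally_series f x0 -> locally_series g x0 ->
  locally_series (fun x => f x + g x) x0.
Proof.
move=> [a fa] [b gb]; exists (fun k => a k + b k).
near=> x.
rewrite (_ : series _ = fun n => series (fun k => a k * (x - x0) ^+ k) n +
  series (fun k => b k * (x - x0) ^+ k) n); last first.
  apply/funext => n; rewrite /series /= -big_split /=.
  by apply: eq_bigr => i _; rewrite mulrDl.
by apply: cvgD; near: x.
Unshelve. all: by end_near. Qed.

Lemma locally_seriesZ c f x0 : locally_series f x0 ->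
  locally_series (fun x => c * f x) x0.
Proof.
move=> [a fa]; exists (fun k => c * a k).
near=> x.
rewrite (_ : series _ = fun n => c * series (fun k => a k * (x - x0) ^+ k) n); last first.
  apply/funext => n; rewrite /series /= mulr_sumr.
  by apply: eq_bigr => i _; rewrite mulrA.
by apply: cvgMr; near: x.
Unshelve. all: by end_near. Qed.

Lemma locally_seriesX f x0 : locally_series f x0 ->
  locally_series (fun x => x * f x) x0.
Proof.
move=> fx0.
suff h : locally_series (fun x => (x - x0) * f x) x0.
  have := locally_seriesD h (locally_seriesZ x0 fx0).
  by under eq_fun do rewrite -mulrDl subrK.
case: fx0 => a fa; exists (fun k => if k is k'.+1 then a k' else 0).
near=> x.
rewrite -(cvg_shiftS (series _)).
rewrite (_ : (fun n => _) =
    fun n => (x - x0) * series (fun k => a k * (x - x0) ^+ k) n); last first.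
  apply/funext => n; rewrite /series /= big_nat_recl//= mul0r add0r mulr_sumr.
  by apply: eq_bigr => i _; rewrite exprS mulrCA.
by apply: cvgMr; near: x.
Unshelve. all: by end_near. Qed.

Lemma locally_series_cvg f x0 : locally_series f x0 -> f x @[x --> x0] --> f x0.
Proof.
move=> [a fa].
have a0 : a 0%N = f x0.
  have := nbhs_singleton fa; rewrite subrr -(cvg_shiftS (series _)).
  rewrite (_ : (fun n => _) = cst (a 0%N)); first by move/cvg_lim => <-//; rewrite lim_cst.
  apply/funext => n; rewrite /series /= big_nat_recl//= expr0 mulr1.
  by rewrite big1 ?addr0// => i _; rewrite exprS mul0r mulr0.
have [e /= e0 he] := fa.
have e20 : 0 < e / 2 by rewrite divr_gt0.
have fe : series (fun k => a k * (e / 2) ^+ k) @ \oo --> f (x0 + e / 2).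
  have := he (x0 + e / 2); rewrite /= (_ : x0 + e / 2 - x0 = e / 2); last by ring.
  apply; rewrite (_ : x0 - (x0 + e / 2) = - (e / 2)); last by ring.
  by rewrite normrN gtr0_norm// ltr_pdivrMr// mulr_natr mulr2n ltrDl.
have [K hK] := power_series_near0 e20 (cvgP _ fe).
apply/cvgrPdist_le => d d0.
have e40 : 0 < e / 2 / 2 by rewrite divr_gt0.
pose r := Num.min (e / 2 / 2) (d / (`|K| + 1)).
have K1 : 0 < `|K| + 1 by rewrite ltr_wpDl.
have r0 : 0 < r by rewrite lt_min e40 divr_gt0.
near=> x.
have xr : `|x - x0| <= r.
  rewrite distrC ltW//; near: x; exact: nbhs_ball_norm.
have hx : series (fun k => a k * (x - x0) ^+ k) @ \oo --> f x by near: x.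
have c : (fun n => `|series (fun k => a k * (x - x0) ^+ k) n.+1 - a 0%N|) @ \oo -->
    `|f x - a 0%N|.
  apply: cvg_norm; apply: cvgB; last exact: cvg_cst.
  by move: hx; rewrite -(cvg_shiftS (series _)).
rewrite distrC -a0; apply: (cvgr_to_le c); apply: nearW => n.
apply: (le_trans (hK _ _ _)).
  by rewrite (le_trans xr)// ge_min lexx.
apply: (@le_trans _ _ ((`|K| + 1) * r)).
  apply: (@le_trans _ _ ((`|K| + 1) * `|x - x0|)); last by rewrite ler_wpM2l// ltW.
  by rewrite ler_wpM2r// (le_trans (ler_norm _))// lerDl.
by rewrite mulrC -ler_pdivlMr// ge_min lexx orbT.
Unshelve. all: by end_near. Qed.

(** One-sided vanishing already forces all the coefficients to be zero, hence
    the function vanishes on the other side too: this is how the zero set moves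
    to the left in [locally_series_identity]. *)
Lemma locally_series_eq0 f x0 d : 0 < d -> locally_series f x0 ->
  (forall x, x0 < x -> x <= x0 + d -> f x = 0) -> \forall x \near x0, f x = 0.
Proof.
move=> d0 [a fa] f0; have [e /= e0 he] := fa.
pose r := Num.min d (e / 2).
have r0 : 0 < r by rewrite lt_min d0 divr_gt0.
have a0 : forall k, a k = 0.
  apply: (power_series_coef0 r0) => h h0 hr.
  have := he (x0 + h); rewrite /= (_ : x0 + h - x0 = h); last by ring.
  move: hr; rewrite le_min => /andP[hd he2].
  rewrite f0 ?lerD2l ?ltrDl//; apply.
  rewrite (_ : x0 - (x0 + h) = - h); last by ring.
  by rewrite normrN gtr0_norm// (le_lt_trans he2)// ltr_pdivrMr// mulr_natr mulr2n ltrDl.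
near=> x.
have hx : series (fun k => a k * (x - x0) ^+ k) @ \oo --> f x by near: x.
apply/esym/(cvg_unique _ _ hx) => //.
rewrite (_ : series _ = cst 0); first exact: cvg_cst.
by apply/funext => n; rewrite /series /= big1// => i _; rewrite a0 mul0r.
Unshelve. all: by end_near. Qed.

(** The identity theorem, by connectedness of the half-line: at the supremum of
    the points where [f] does not vanish, [f] is zero on the right, hence zero
    in a neighbourhood, a contradiction. *)
Lemma locally_series_identity f a b : a < b ->
  (forall x, a < x -> locally_series f x) ->
  (forall x, b < x -> f x = 0) -> forall x, a < x -> f x = 0.
Proof.
move=> ab lf f0 x ax; apply/eqP; apply/negP => /negP fx.
pose S := [set y | a < y /\ f y != 0].
have Sb : ubound S b.
  move=> y [_ fy]; rewrite leNgt; apply/negP => /f0 /eqP.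
  by rewrite (negbTE fy).
have Sx : S x by [].
have hS : has_sup S by split; [exists x | exists b].
have xS : x <= sup S by apply: sup_upper_bound.
have fS y : sup S < y -> f y = 0.
  move=> Sy; apply/eqP; apply/negP => /negP fy.
  have : y <= sup S.
    apply: sup_upper_bound => //; split => //.
    by rewrite (lt_trans _ Sy)// (lt_le_trans ax).
  by rewrite leNgt Sy.
have [e /= e0 he] := locally_series_eq0 ltr01 (lf _ (lt_le_trans ax xS)) (fun y h _ => fS y h).
have [y [ay fy] Sy] := sup_adherent e0 hS.
have : f y = 0.
  apply: he; rewrite /ball_ /= ger0_norm ?subr_ge0; last exact: sup_upper_bound.
  by rewrite ltrBlDr addrC -ltrBlDr.
by move/eqP; rewrite (negbTE fy).
Qed.

End LocalSeriesClosure.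

(** * Mellin integrals as local power series in the exponent *)

Section MellinSeries.
Variable R : realType.
Local Notation mu := (@lebesgue_measure R).
Local Notation RT := (measurableTypeR R).

Lemma normr_exp_coeff (y z : R) n : `|y| <= z -> `|exp_coeff y n| <= exp_coeff z n.
Proof.
move=> yz; have z0 : 0 <= z by exact: le_trans yz.
rewrite /exp_coeff /= normrM normrX (ger0_norm (x := _^-1)) ?invr_ge0//.
by rewrite ler_wpM2r ?invr_ge0// lerXn2r ?nnegrE.
Qed.

Lemma series_exp_coeff_le (z : R) n : 0 <= z -> series (exp_coeff z) n <= expR z.
Proof.
move=> z0; apply: nondecreasing_cvgn_le; last exact: is_cvg_series_exp_coeff.
by apply: nondecreasing_series => k _ _; exact: exp_coeff_ge0.
Qed.

Lemma normr_series_exp_coeff (y z : R) n : `|y| <= z ->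
  `|series (exp_coeff y) n| <= expR z.
Proof.
move=> yz; apply: le_trans (series_exp_coeff_le n (le_trans (normr_ge0 _) yz)).
rewrite /series /= (le_trans (ler_norm_sum _ _ _))//.
by apply: ler_sum => i _; exact: normr_exp_coeff.
Qed.

Lemma exp_coeff_le (y z : R) n : `|y| <= z -> `|exp_coeff y n| <= expR z.
Proof.
move=> yz; have z0 : 0 <= z by exact: le_trans yz.
apply: (le_trans (normr_exp_coeff n yz)).
apply: le_trans (series_exp_coeff_le n.+1 z0).
by rewrite /series /= big_nat_recr//= lerDr sumr_ge0// => i _; exact: exp_coeff_ge0.
Qed.

(** With [h = p - p0], the power series [x^(-h) = \sum_k (- h ln x)^k / k!] is
    integrated term by term.  For [|h| <= p0 / 2] all its partial sums are at
    most [x^(p0 / 2)], and [x^(-1 - p0 / 2)] is integrable, so dominated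
    convergence applies. *)
Lemma locally_series_mellin (m : R -> R) (p0 : R) : 0 < p0 ->
  measurable_fun [set: R] m -> (forall x, `|m x| <= 1) ->
  locally_series (fun p => \int[mu]_(x in `[1, +oo[) (m x * x `^ (- 1 - p))) p0.
Proof.
move=> p00 mm m1.
have [d d0 dE] : exists2 d, 0 < d & p0 = d + d.
  by exists (p0 / 2); [rewrite divr_gt0|field].
pose w k (x : R) := m x * x `^ (- 1 - p0) * exp_coeff (- ln x) k.
have mexp k : measurable_fun [set: R] (fun x => exp_coeff (- ln x) k).
  apply: measurable_funM => //; apply: measurable_funX; apply: measurable_funN.
  exact: measurable_ln.
have mw k : measurable_fun [set: R] (w k).
  by apply: measurable_funM => //; apply: measurable_funM => //; exact: measurable_powR.
have id := integrable_powR_cy d0.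
have powE x : 1 <= x -> x `^ (- 1 - p0) * expR (d * ln x) = x `^ (- 1 - d).
  move=> x1; have x0 : 0 < x by exact: lt_le_trans x1.
  rewrite (_ : expR _ = x `^ d); last by rewrite /powR gt_eqF.
  rewrite -powRD ?(gt_eqF x0) ?implybT//; congr powR.
  by rewrite dE; ring.
have iw k : mu.-integrable `[1, +oo[ (EFin \o w k).
  apply: (integrable_dominated _ _ (integrable_finZ (d ^- k) _ id)) => //.
    exact: measurable_funTS (mw k).
  move=> x /=; rewrite in_itv/= andbT => x1.
  have lx : 0 <= ln x by rewrite ln_ge0.
  have e : `|exp_coeff (- (d * ln x)) k| <= expR (d * ln x).
    by apply: exp_coeff_le; rewrite normrN ger0_norm// mulr_ge0// ltW.
  have E : exp_coeff (- ln x) k = d ^- k * exp_coeff (- (d * ln x)) k.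
    by rewrite /exp_coeff /= -mulrN exprMn -mulrA mulKf// expf_neq0// gt_eqF.
  rewrite /w -(powE x x1) E normrM normrM (ger0_norm (powR_ge0 _ _)) normrM.
  rewrite (ger0_norm (x := d ^- k)) ?invr_ge0 ?exprn_ge0 ?(ltW d0)//.
  rewrite [leRHS]mulrCA; apply: ler_pM; rewrite ?mulr_ge0 ?powR_ge0 ?invr_ge0 ?exprn_ge0 ?(ltW d0)//.
    by rewrite ler_piMl ?powR_ge0.
  by rewrite ler_wpM2l ?invr_ge0 ?exprn_ge0 ?(ltW d0).
exists (fun k => \int[mu]_(x in `[1, +oo[) w k x).
near=> p; set h := p - p0.
have hd : `|h| <= d by rewrite distrC ltW//; near: p; exact: nbhs_ball_norm.
pose S n (x : RT) := m x * x `^ (- 1 - p0) * series (exp_coeff (- (h * ln x))) n.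
have SE n (x : RT) : S n x = \sum_(0 <= k < n) w k x * h ^+ k.
  rewrite /S /series /= mulr_sumr; apply: eq_bigr => k _.
  by rewrite /w -!mulrA; congr (_ * (_ * _)); rewrite /exp_coeff /= -mulrN exprMn; ring.
have mS n : measurable_fun [set: R] (S n).
  rewrite (_ : S n = fun x => \sum_(0 <= k < n) w k x * h ^+ k); last exact/funext.
  apply: measurable_sum => k; exact: measurable_funM.
have iS n : mu.-integrable `[1, +oo[ (EFin \o S n) /\
    \int[mu]_(x in `[1, +oo[) S n x =
    series (fun k => \int[mu]_(x in `[1, +oo[) w k x * h ^+ k) n.
  elim: n => [|n [IHi IH]].
    rewrite (_ : S 0%N = cst 0); last first.
      by apply/funext => x; rewrite SE big_geq.
    by split; [exact: integrable0|rewrite /series /= big_geq// Rintegral_cst// mul0r].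
  have iwh : mu.-integrable `[1, +oo[ (EFin \o (fun x => h ^+ n * w n x)).
    exact: integrable_finZ.
  have E : S n.+1 = fun x => S n x + h ^+ n * w n x.
    by apply/funext => x; rewrite !SE big_nat_recr//= mulrC.
  rewrite E; split; first exact: integrable_finD.
  by rewrite RintegralD// IH RintegralZl// /series /= big_nat_recr//= [h ^+ n * _]mulrC.
rewrite (_ : series _ = fun n => \int[mu]_(x in `[1, +oo[) S n x); last first.
  by apply/funext => n; rewrite (iS n).2.
apply: (cvg_Rintegral_dominated (v := fun x => x `^ (- 1 - d))) => //.
- by move=> n; exact: measurable_funTS (mS n).
- by apply: measurable_funTS; apply: measurable_funM => //; exact: measurable_powR.
- move=> x /=; rewrite in_itv/= andbT => x1; have x0 : 0 < x by exact: lt_le_trans x1.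
  rewrite (_ : - 1 - p = (- 1 - p0) + (- h)); last by rewrite /h; ring.
  rewrite powRD ?(gt_eqF x0) ?implybT// mulrA; apply: cvgMr.
  rewrite (_ : x `^ (- h) = expR (- (h * ln x))); last by rewrite /powR gt_eqF// mulNr.
  exact: is_cvg_series_exp_coeff.
- move=> n x /=; rewrite in_itv/= andbT => x1.
  have lx : 0 <= ln x by rewrite ln_ge0.
  rewrite /S -(powE x x1) normrM normrM (ger0_norm (powR_ge0 _ _)).
  apply: ler_pM; rewrite ?mulr_ge0 ?powR_ge0//.
    by rewrite ler_piMl ?powR_ge0.
  apply: normr_series_exp_coeff; rewrite normrN normrM (ger0_norm lx).
  by rewrite ler_wpM2r.
Unshelve. all: by end_near. Qed.

End MellinSeries.

(** * Analytic functions on lines of the complex plane *)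

Section ComplexLocalSeries.
Variable R : realType.
Local Notation fract_kernel := (mellin_kernel (@fract_part R)).
Implicit Types (f g : R -> R[i]) (x t : R) (c d z s : R[i]).

(** The variable stays real: only restrictions of analytic functions to lines
    are considered, so that the real identity theorem applies to each part. *)
Definition clocally_series f x0 : Prop :=
  locally_series (fun x => complex.Re (f x)) x0 /\
  locally_series (fun x => complex.Im (f x)) x0.

Lemma clocally_series_cst c x0 : clocally_series (fun=> c) x0.
Proof. by split; exact: locally_series_cst. Qed.

Lemma clocally_seriesD f g x0 : clocally_series f x0 -> clocally_series g x0 ->
  clocally_series (fun x => f x + g x) x0.
Proof.
move=> [fr fi] [gr gi]; split.
- by under eq_fun do rewrite cReD; exact: locally_seriesD.
- by under eq_fun do rewrite cImD; exact: locally_seriesD.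
Qed.

Lemma clocally_seriesZ c f x0 : clocally_series f x0 ->
  clocally_series (fun x => c * f x) x0.
Proof.
move=> [fr fi]; split.
- under eq_fun do rewrite cReM -mulNr.
  by apply: locally_seriesD; exact: locally_seriesZ.
- under eq_fun do rewrite cImM.
  by apply: locally_seriesD; exact: locally_seriesZ.
Qed.

Lemma clocally_seriesX f x0 : clocally_series f x0 ->
  clocally_series (fun x => x%:C * f x) x0.
Proof.
move=> [fr fi]; split.
- under eq_fun do rewrite cReM /= mul0r subr0.
  exact: locally_seriesX.
- under eq_fun do rewrite cImM /= mul0r addr0.
  exact: locally_seriesX.
Qed.

Lemma clocally_seriesM f t x0 : clocally_series f x0 ->
  clocally_series (fun x => (x +i* t) * f x) x0.
Proof.
move=> fx0.
rewrite (_ : (fun x => _) = fun x => x%:C * f x + t *i * f x); last first.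
  apply/funext => x; rewrite -mulrDl; congr (_ * _).
  by apply: complex_eqP; rewrite !cpartE /= ?addr0 ?add0r.
by apply: clocally_seriesD; [exact: clocally_seriesX|exact: clocally_seriesZ].
Qed.

(** Used with [d = 1] for horizontal lines, where the identity theorem is
    applied, and with [d = i] for the continuity of [zeta] across the real
    line. *)
Lemma analytic_at_line (F : R[i] -> R[i]) z0 d x0 : `|d| = 1 -> analytic_at F z0 ->
  clocally_series (fun x => F (z0 + (x - x0)%:C * d)) x0.
Proof.
move=> d1 [a Fa].
have h : \forall x \near x0,
    ccvg (series (fun k => a k * d ^+ k * ((x - x0) ^+ k)%:C)) (F (z0 + (x - x0)%:C * d)).
  have [e /= e0 he] := Fa.
  have eE : e = (complex.Re e)%:C by rewrite RRe_real// gtr0_real.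
  have e0' : 0 < complex.Re e by rewrite -ltcR -eE.
  near=> x.
  have : ball_ (Num.norm : R[i] -> R[i]) z0 e (z0 + (x - x0)%:C * d).
    rewrite /ball_ /= opprD addrA subrr add0r normrN normrM d1 mulr1 eE.
    rewrite normc_def /= expr0n addr0 sqrtr_sqr ltcR distrC.
    by near: x; exact: (nbhs_ball_norm x0 (PosNum e0')).
  move/he => /cvg_ccvg.
  rewrite (_ : series _ = series (fun k => a k * d ^+ k * ((x - x0) ^+ k)%:C))//.
  apply/funext => n; apply: eq_bigr => k _.
  by rewrite addrC addKr exprMn rmorphXn mulrA mulrAC.
split.
- exists (fun k => complex.Re (a k * d ^+ k)).
  near=> x.
  have [hr _] : ccvg (series (fun k => a k * d ^+ k * ((x - x0) ^+ k)%:C))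
    (F (z0 + (x - x0)%:C * d)) by near: x.
  rewrite (_ : series _ = fun n => complex.Re
    (series (fun k => a k * d ^+ k * ((x - x0) ^+ k)%:C) n))//.
  apply/funext => n; rewrite /series /= (big_morph _ (@cReD R) (erefl : complex.Re 0 = 0)).
  by apply: eq_bigr => k _; rewrite [RHS]cReM /= mulr0 subr0.
- exists (fun k => complex.Im (a k * d ^+ k)).
  near=> x.
  have [_ hi] : ccvg (series (fun k => a k * d ^+ k * ((x - x0) ^+ k)%:C))
    (F (z0 + (x - x0)%:C * d)) by near: x.
  rewrite (_ : series _ = fun n => complex.Im
    (series (fun k => a k * d ^+ k * ((x - x0) ^+ k)%:C) n))//.
  apply/funext => n; rewrite /series /= (big_morph _ (@cImD R) (erefl : complex.Im 0 = 0)).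
  by apply: eq_bigr => k _; rewrite [RHS]cImM /= mulr0 add0r.
Unshelve. all: by end_near. Qed.

Lemma clocally_series_fract_mellin t x0 : 0 < x0 ->
  clocally_series (fun x => cintegral `[1, +oo[ (fract_kernel (x +i* t))) x0.
Proof.
move=> x00.
have mln : measurable_fun [set: R] (fun x => - t * ln x).
  by apply: measurable_funM => //; exact: measurable_ln.
have m1 (k : R -> R) x : `|k x| <= 1 -> `|fract_part x * k x| <= 1.
  move=> k1; rewrite normrM (ger0_norm (fract_part_ge0 _)).
  by rewrite mulr_ile1 ?fract_part_ge0// ltW// fract_part_lt1.
split => /=.
- rewrite (_ : (fun x => _) = fun p => \int[lebesgue_measure]_(x in `[1, +oo[)
      (fract_part x * cos (- t * ln x) * x `^ (- 1 - p))); last first.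
    apply/funext => p; apply: eq_Rintegral => x _.
    by rewrite mul0r subr0 oppr0 sub0r mulrAC mulrA.
  apply: locally_series_mellin => //.
    apply: measurable_funM; first exact: measurable_fract_part.
    by apply: measurableT_comp mln; exact: continuous_measurable_fun (@continuous_cos R).
  by move=> x; apply: (m1 (fun x => cos (- t * ln x))); rewrite ler_norml cos_geN1 cos_le1.
- rewrite (_ : (fun x => _) = fun p => \int[lebesgue_measure]_(x in `[1, +oo[)
      (fract_part x * sin (- t * ln x) * x `^ (- 1 - p))); last first.
    apply/funext => p; apply: eq_Rintegral => x _.
    by rewrite mul0r addr0 oppr0 sub0r mulrAC mulrA.
  apply: locally_series_mellin => //.
    apply: measurable_funM; first exact: measurable_fract_part.
    by apply: measurableT_comp mln; exact: continuous_measurable_fun (@continuous_sin R).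
  by move=> x; apply: (m1 (fun x => sin (- t * ln x))); rewrite ler_norml sin_geN1 sin_le1.
Qed.

End ComplexLocalSeries.

(** * The zeta function in the critical strip *)

Section ZetaMellin.
Variable R : realType.
Local Notation fract_kernel := (mellin_kernel (@fract_part R)).
Variable zeta : R[i] -> R[i].
Hypothesis hzeta : is_riemann_zeta zeta.
Implicit Types (x t : R) (s : R[i]).

Let I s := cintegral `[1, +oo[ (fract_kernel s).
(** The claim [zeta s = 1 - (1 - s)^-1 - s * I s] multiplied by [s - 1], so that
    [zeta] and [I] are combined by polynomials only and no expansion of an
    inverse is needed. *)
Let defect s := (s - 1) * (zeta s - 1 + s * I s) - 1.

Let defect_gt1 s : 1 < complex.Re s -> defect s = 0.
Proof.
move=> s1; rewrite /defect (zeta_mellin_cy hzeta s1) -/(I s); field.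
by rewrite subr1_neq0// gt_eqF.
Qed.

(** Off the real axis the whole horizontal line avoids the pole, and the
    identity theorem carries the vanishing of [defect] from [1 < x] to
    [0 < x]. *)
Let defect_im x t : t != 0 -> 0 < x -> defect (x +i* t) = 0.
Proof.
move=> t0.
have zx x0 : clocally_series (fun x => zeta (x +i* t)) x0.
  have n1 : x0 +i* t != 1 by rewrite eq_complex /= negb_and t0 orbT.
  have := analytic_at_line x0 (normr1 _) (hzeta.2 _ n1).
  rewrite (_ : (fun x => zeta _) = fun x => zeta (x +i* t))//.
  apply/funext => y; congr zeta.
  by apply: complex_eqP; rewrite /= ?mulr1 ?mulr0; ring.
have dx x0 : 0 < x0 -> clocally_series (fun x => defect (x +i* t)) x0.
  move=> x00; pose G x := zeta (x +i* t) - 1 + (x +i* t) * I (x +i* t).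
  have Gx : clocally_series G x0.
    apply: clocally_seriesD.
      by apply: clocally_seriesD => //; exact: clocally_series_cst.
    apply: clocally_seriesM; exact: clocally_series_fract_mellin.
  rewrite (_ : (fun x => _) =
      fun x => (x +i* t) * G x + (- 1) * G x + (- 1)); last first.
    by apply/funext => y; rewrite /defect mulrBl mul1r mulN1r.
  apply: clocally_seriesD; last exact: clocally_series_cst.
  by apply: clocally_seriesD; [exact: clocally_seriesM|exact: clocally_seriesZ].
move: x; have h x : 1 < x -> defect (x +i* t) = 0 by move=> x1; exact: defect_gt1.
move=> x x0; apply: complex_eqP.
- apply: (@locally_series_identity _ (fun x => complex.Re (defect (x +i* t))) 0 1) => //.
    by move=> y /dx[].
  by move=> y /h ->.
- apply: (@locally_series_identity _ (fun x => complex.Im (defect (x +i* t))) 0 1) => //.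
    by move=> y /dx[].
  by move=> y /h ->.
Qed.

Let tau (n : nat) : R := n.+1%:R^-1.

Let cvg_tau : tau @ \oo --> 0.
Proof. exact: cvg_harmonic. Qed.

Let ccvg_zeta x : x != 1 -> ccvg (fun n => zeta (x +i* tau n)) (zeta x%:C).
Proof.
move=> x1.
have n1 : x%:C != 1 by rewrite eq_complex /= negb_and x1.
have i1 : `|'i%C : R[i]| = 1 by rewrite normc_def /= expr0n expr1n add0r sqrtr1.
have E : (fun y : R => zeta (x%:C + (y - 0)%:C * 'i)) = fun y => zeta (x +i* y).
  apply/funext => y; congr zeta.
  by apply: complex_eqP; rewrite /= ?mulr1 ?mulr0; ring.
have := analytic_at_line 0 i1 (hzeta.2 _ n1); rewrite E.
move=> [/locally_series_cvg cr /locally_series_cvg ci]; split.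
- exact: cvg_comp cvg_tau cr.
- exact: cvg_comp cvg_tau ci.
Qed.

Let ccvg_I x : 0 < x -> ccvg (fun n => I (x +i* tau n)) (I x%:C).
Proof.
move=> x0.
have c0 (y : R) : (fun n => (- 0 - tau n) * ln y) @ \oo --> (- 0 - 0) * ln y.
  by apply: cvgMl; apply: cvgB => //; exact: cvg_cst.
split; apply: (cvg_Rintegral_dominated (v := fun y => y `^ (- 1 - x))) => //.
- by move=> n; exact: measurable_Re_mellin_kernel (@measurable_fract_part R).
- exact: measurable_Re_mellin_kernel (@measurable_fract_part R).
- move=> y _; rewrite Re_mellin_kernel; under eq_fun do rewrite Re_mellin_kernel.
  apply: cvgMr; rewrite /=; apply: cvgMr.
  apply: (cvg_comp (fun n => (- 0 - tau n) * ln y) cos (c0 y)); exact: continuous_cos.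
- exact: integrable_powR_cy.
- move=> n y _; apply: le_trans (normr_Re_mellin_kernel _ (fract_part_ge0 _)) _.
  by rewrite ler_piMl ?powR_ge0// ltW// fract_part_lt1.
- by move=> n; exact: measurable_Im_mellin_kernel (@measurable_fract_part R).
- exact: measurable_Im_mellin_kernel (@measurable_fract_part R).
- move=> y _; rewrite Im_mellin_kernel; under eq_fun do rewrite Im_mellin_kernel.
  apply: cvgMr; rewrite /=; apply: cvgMr.
  apply: (cvg_comp (fun n => (- 0 - tau n) * ln y) sin (c0 y)); exact: continuous_sin.
- exact: integrable_powR_cy.
- move=> n y _; apply: le_trans (normr_Im_mellin_kernel _ (fract_part_ge0 _)) _.
  by rewrite ler_piMl ?powR_ge0// ltW// fract_part_lt1.
Qed.

(** A horizontal path from a real point of the strip to [1 < Re s] would cross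
    the pole; real points are limits of points off the real axis instead. *)
Let defect0 s : 0 < complex.Re s -> complex.Re s < 1 -> defect s = 0.
Proof.
case: s => x t /= x0 x1; have [->|t0] := eqVneq t 0; last exact: defect_im.
have n1 : x != 1 by rewrite lt_eqF.
have ct : ccvg (fun n => x +i* tau n) x%:C by split; [exact: cvg_cst|exact: cvg_tau].
apply/esym/(@ccvg_unique _ (fun n => defect (x +i* tau n))).
- rewrite (_ : (fun n => _) = fun=> 0); first exact: ccvg_cst.
  by apply/funext => n; rewrite defect_im// invr_eq0 pnatr_eq0.
- apply: ccvgD; last exact: ccvg_cst.
  apply: ccvgM; first by apply: ccvgD => //; exact: ccvg_cst.
  apply: ccvgD; first by apply: ccvgD; [exact: ccvg_zeta|exact: ccvg_cst].
  by apply: ccvgM => //; exact: ccvg_I.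
Qed.

Lemma zeta_mellin s : 0 < complex.Re s -> complex.Re s < 1 ->
  zeta s / (- s) = cintegral `]0, +oo[ (fract_kernel s).
Proof.
move=> s0 s1.
have ns1 : 1 - s != 0 by rewrite subr1_neq0// lt_eqF.
have sn0 : s != 0 by apply: contraTneq s0 => ->; rewrite ltxx.
have U : `]0, +oo[%classic = `]0, 1[ `|` `[1, +oo[ :> set R.
  by apply: itv_bndbnd_setU; rewrite bnd_simp.
have ik := cintegrable_fract_kernel s0 s1.
rewrite U cintegral_setU//; last 2 first.
- apply/disj_setPS => x [] /=; rewrite !in_itv/= andbT => /andP[_ xn] nx.
  by move: (lt_le_trans xn nx); rewrite ltxx.
- by rewrite -U.
rewrite cintegral_fract_kernel_0c// -/(I s).
have := defect0 s0 s1; rewrite /defect => /eqP; rewrite subr_eq0 => /eqP E.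
have -> : zeta s = 1 - s * I s - (1 - s)^-1.
  apply: (mulfI ns1).
  rewrite (_ : (1 - s) * zeta s =
    - ((s - 1) * (zeta s - 1 + s * I s)) + (1 - s) * (1 - s * I s)); last by ring.
  by rewrite E; field.
field.
by rewrite sn0 ns1.
Qed.

End ZetaMellin.

(** * Scaling of the Lebesgue measure *)

Section Scaling.
Variable R : realType.
Local Notation mu := (@lebesgue_measure R).
Local Notation RT := (measurableTypeR R).
Local Open Scope ereal_scope.

Section scale_pos.
Variables (u : R) (u0 : (0 < u)%R).

Let scale (x : RT) : RT := (x / u)%R.

Let mscaleu : measurable_fun setT scale.
Proof. exact: measurable_funM. Qed.

Let ui0 : (0 <= u^-1)%R. Proof. by rewrite invr_ge0 ltW. Qed.

(** Both sides agree on half-open intervals, which determine a measure. *)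
Lemma lebesgue_measure_scale (A : set RT) : measurable A ->
  pushforward mu scale A = u%:E * mu A.
Proof.
move=> mA.
pose nu := mscale (NngNum ui0) (pushforward mu scale).
have /= -> : mu A = nu mscaleu A; last first.
  by rewrite /nu /mscale /= muleA -EFinM divff ?mul1e// gt_eqF.
apply: lebesgue_measure_unique mA => _ [[a b]] _ <- /=.
rewrite /nu /mscale /= /pushforward.
rewrite (_ : _ @^-1` _ = `](a * u)%R, (b * u)%R]%classic); last first.
  apply/seteqP; split => x /=; rewrite !in_itv/= /scale ltr_pdivlMr ?ler_pdivrMr//.
rewrite !lebesgue_measure_itv/= !lte_fin ltr_pM2r//.
case: ifPn => ab; last by rewrite mule0.
by rewrite -!EFinB -EFinM; congr EFin; field; rewrite gt_eqF.
Qed.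

Lemma ge0_integral_scale (f : RT -> \bar R) : measurable_fun setT f ->
  (forall x, 0 <= f x) ->
  \int[mu]_x f (x / u)%R = u%:E * \int[mu]_x f x.
Proof.
move=> mf f0.
transitivity (\int[pushforward mu scale]_x f x).
  by rewrite ge0_integral_pushforward.
rewrite -(@ge0_integral_mscale _ _ _ mu setT measurableT (NngNum (ltW u0)))//.
apply: eq_measure_integral => //= A mA _.
exact: lebesgue_measure_scale.
Qed.

Lemma integral_scale (f : RT -> \bar R) : mu.-integrable setT f ->
  \int[mu]_x f (x / u)%R = u%:E * \int[mu]_x f x.
Proof.
move=> fi; have mf := measurable_int _ fi.
have hp := ge0_integral_scale (measurable_funepos mf) (funepos_ge0 f).
have hn := ge0_integral_scale (measurable_funeneg mf) (funeneg_ge0 f).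
rewrite [in RHS]integralE muleBr//; last first.
  by apply: fin_num_adde_defl; rewrite fin_numN; exact: integrable_neg_fin_num.
rewrite -hp -hn [LHS]integralE; congr (_ - _).
- by apply: eq_integral => x _; rewrite -[RHS]/((f^\+ \o scale) x) -funepos_comp.
- by apply: eq_integral => x _; rewrite -[RHS]/((f^\- \o scale) x) -funeneg_comp.
Qed.

End scale_pos.

End Scaling.

(** * Multiplicative convolution *)

Section MultiplicativeConvolution.
Variable R : realType.
Local Notation mu := (@lebesgue_measure R).
Local Notation RT := (measurableTypeR R).

Variables (f g : RT -> R) (p : R).
Hypothesis mf : measurable_fun setT f.
Hypothesis mg : measurable_fun setT g.
Hypothesis f0 : forall x, 0 <= f x.
Hypothesis g0 : forall x, 0 <= g x.
Hypothesis f_pos : forall x, x <= 0 -> f x = 0.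
Hypothesis g_pos : forall x, x <= 0 -> g x = 0.

Let w (x : R) := x `^ (- 1 - p).

Hypothesis ifw : mu.-integrable setT (EFin \o (fun x => f x * w x)).
Hypothesis igw : mu.-integrable setT (EFin \o (fun x => g x * w x)).

Let H (x u : RT) : R := f u * g (x / u) / u.

(** The functions to be convolved vanish outside the positive half-line; so the
    integral may run over all of [R], the values of [g (x / u) / u] at [u <= 0]
    being killed by [f u], and Fubini can be used on [R * R]. *)
Definition mconv (x : R) : R := \int[mu]_u (f u * g (x / u) / u).

Let w_gt0 x : 0 < x -> 0 < w x. Proof. exact: powR_gt0. Qed.

Let wM x y : 0 < x -> 0 < y -> w (x * y) = w x * w y.
Proof. by move=> x0 y0; rewrite /w powRM ?ltW. Qed.

Let H0 x u : x <= 0 -> H x u = 0.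
Proof.
move=> x0; rewrite /H; have [u0|u0] := leP u 0; first by rewrite f_pos// !mul0r.
by rewrite g_pos ?mulr0 ?mul0r// pmulr_lle0// invr_gt0.
Qed.

Let H_ge0 x u : 0 <= H x u.
Proof.
rewrite /H; have [u0|u0] := leP u 0; first by rewrite f_pos// !mul0r.
by rewrite !mulr_ge0// invr_ge0 ltW.
Qed.

Let measurable_H : measurable_fun setT (fun z : RT * RT => H z.1 z.2).
Proof.
(* [u^-1] is replaced by the power [u `^ (- 1)], known to be measurable; they
   differ only at [u < 0], where [f u = 0] *)
rewrite (_ : (fun z => _) = fun z : RT * RT =>
    f z.2 * g (z.1 * z.2 `^ (- 1)) * z.2 `^ (- 1)); last first.
  apply/funext => -[x u] /=; rewrite /H.
  have [u0|u0] := leP u 0; first by rewrite f_pos// !mul0r.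
  by rewrite powR_inv1// ltW.
have mi : measurable_fun setT (fun z : RT * RT => z.2 `^ (- 1)).
  exact: (measurableT_comp (measurable_powR (- 1))).
apply: measurable_funM => //; apply: measurable_funM.
  exact: (measurableT_comp mf).
by apply: (measurableT_comp mg); exact: measurable_funM.
Qed.

Let measurable_w : measurable_fun setT w.
Proof. exact: measurable_powR. Qed.

(** Multiplicativity of [w] separates the variables [u] and [x / u]. *)
Let Hw x u : H x u * w x = f u * w u / u * (g (x / u) * w (x / u)).
Proof.
have [u0|u0] := leP u 0; first by rewrite /H f_pos// !mul0r.
have [x0|x0] := leP x 0.
  by rewrite H0// [g (x / u)]g_pos ?mul0r ?mulr0// pmulr_lle0// invr_gt0.
have -> : w x = w u * w (x / u) by rewrite -wM ?divr_gt0// mulrCA divff ?mulr1// gt_eqF.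
by rewrite /H; ring.
Qed.

Local Open Scope ereal_scope.

(** By Tonelli, the integral is the product of those of [f * w] and [g * w]. *)
Let integrable_Hw : (mu \x mu).-integrable setT
  (fun z : RT * RT => (H z.1 z.2 * w z.1)%:E).
Proof.
apply/integrable21ltyP.
  apply/measurable_EFinP; apply: measurable_funM => //.
  exact: measurableT_comp.
have gfin : \int[mu]_x (g x * w x)%:E \is a fin_num by exact: integrable_fin_num.
rewrite (@eq_integral _ _ _ mu setT
    (fun u => (f u * w u)%:E * \int[mu]_x (g x * w x)%:E)).
  rewrite -(fineK gfin).
  have := integrableZr measurableT (fine (\int[mu]_x (g x * w x)%:E)) ifw.
  move=> /integrable_lty; apply.
  exact: measurableT.
move=> u _ /=.
have [u0|u0] := leP u 0%R.
  rewrite f_pos// mul0r mul0e; apply: integral0_eq => x _.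
  by rewrite /H f_pos// !mul0r normr0.
rewrite (@eq_integral _ _ _ mu setT
    (fun x => (fun y => (f u * w u / u)%:E * (g y * w y)%:E) (x / u)%R)); last first.
  move=> x _ /=; rewrite Hw -EFinM ger0_norm//.
  by rewrite !mulr_ge0 ?powR_ge0 ?invr_ge0 ?(ltW u0).
rewrite (@ge0_integral_scale _ u u0 (fun y => (f u * w u / u)%:E * (g y * w y)%:E)).
- rewrite (integralZl measurableT igw).
  rewrite muleA -EFinM; congr (_%:E * _); field.
  by rewrite gt_eqF.
- apply: emeasurable_funM; first exact: measurable_cst.
  by apply/measurable_EFinP; exact: measurable_funM.
- move=> y; rewrite -EFinM lee_fin.
  by rewrite !mulr_ge0 ?powR_ge0 ?invr_ge0 ?(ltW u0).
Qed.

Let integrable_H : {ae mu, forall x, mu.-integrable setT (fun u => (H x u)%:E)}.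
Proof.
have := ae_integrable1 integrable_Hw; apply: filterS => x /= ix.
have [x0|x0] := leP x 0%R.
  rewrite (_ : (fun u => _) = cst 0%R); first exact: integrable0.
  by apply/funext => u; rewrite H0.
have := integrable_finZ (w x)^-1 measurableT ix.
congr (integrable _ _); apply/funext => u /=.
by rewrite mulrC mulfK// gt_eqF// w_gt0.
Qed.

Let mconvE x : mu.-integrable setT (fun u => (H x u)%:E) ->
  \int[mu]_u (H x u)%:E = (mconv x)%:E.
Proof. by move=> ix; rewrite /mconv /Rintegral fineK//; exact: integrable_fin_num. Qed.

Lemma mconv_ge0 x : (0 <= mconv x)%R.
Proof. by apply: Rintegral_ge0 => u _; exact: H_ge0. Qed.

Lemma measurable_mconv : measurable_fun setT mconv.
Proof.
have : measurable_fun setT (fubini_F mu (fun z : RT * RT => (H z.1 z.2)%:E)).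
  apply: measurable_fun_fubini_tonelli_F.
    exact/measurable_EFinP.
  by move=> z; rewrite lee_fin H_ge0.
by move=> mF; exact: (measurableT_comp (fine_measurable measurableT) mF).
Qed.

(** [w] itself proves integrability; the two parts of [cpow x (- 1 - s)], which
    change sign, give the transform. *)
Section kernel.
Variable k : RT -> R.
Hypothesis mk : measurable_fun setT k.
Hypothesis kw : forall x, (0 < x)%R -> (`|k x| <= w x)%R.

Let integrable_Hk : (mu \x mu).-integrable setT
  (fun z : RT * RT => (H z.1 z.2 * k z.1)%:E).
Proof.
apply: (le_integrable _ _ _ integrable_Hw) => //.
  apply/measurable_EFinP; apply: measurable_funM => //.
  exact: measurableT_comp.
move=> [x u] _ /=; rewrite lee_fin (normrM (H x u)) (normrM (H x u)).
have [x0|x0] := leP x 0%R; first by rewrite H0// normr0 !mul0r.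
by rewrite ler_wpM2l// (le_trans (kw x0))// ler_norm.
Qed.

Let inner_x x : mu.-integrable setT (fun u => (H x u)%:E) ->
  \int[mu]_u (H x u * k x)%:E = (mconv x * k x)%:E.
Proof.
move=> ix; rewrite EFinM -mconvE// -integralZr//.
Qed.

(** Where the inner integral diverges, [mconv x] is [0], the value that
    [Rintegral] gives to an infinite integral, so the bound by the integrable function of Fubini holds
    at every [x] and not only almost everywhere. *)
Lemma integrable_mconv : mu.-integrable setT (EFin \o (fun x => mconv x * k x)%R).
Proof.
have := integrable_fubini_F integrable_Hk; apply: le_integrable => //.
  by apply/measurable_EFinP; apply: measurable_funM => //; exact: measurable_mconv.
move=> x _ /=; rewrite /fubini_F /=.
have [h|h] := pselect (mu.-integrable setT (fun u => (H x u)%:E)).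
  by rewrite inner_x.
rewrite (_ : mconv x = 0%R) ?mul0r ?normr0 ?abse_ge0//.
rewrite /mconv /Rintegral.
have : ~ (\int[mu]_u (H x u)%:E < +oo).
  move=> hl; apply: h; apply/integrableP; split.
    apply/measurable_EFinP.
    exact: (measurableT_comp measurable_H (measurable_pair1 x)).
  by under eq_integral do rewrite /= ger0_norm ?H_ge0//.
move/negP; rewrite -leNgt leye_eq => /eqP.
by rewrite /H => ->.
Qed.

Let igk u : (0 < u)%R -> mu.-integrable setT (EFin \o (fun y => g y * k (u * y))%R).
Proof.
move=> u0; apply: (@integrable_dominated _ _ _ _ _ _ (integrable_finZ (w u) _ igw)) => //.
  apply: measurable_funM => //; apply: (measurableT_comp mk).
  exact: measurable_funM.
move=> y _; have [y0|y0] := leP y 0%R; first by rewrite g_pos// !mul0r normr0 mulr0.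
rewrite normrM ger0_norm// mulrCA ler_wpM2l//.
by rewrite -wM// kw// mulr_gt0.
Qed.

(** Fubini, then the substitution [x = u y] in the inner integral. *)
Lemma Rintegral_mconv :
  (\int[mu]_x (mconv x * k x) = \int[mu]_u (f u * \int[mu]_y (g y * k (u * y))))%R.
Proof.
rewrite /Rintegral; congr fine.
rewrite (@ae_eq_integral _ _ _ mu setT
    (fun x => \int[mu]_u (H x u * k x)%:E)) //; last 3 first.
- by apply/measurable_EFinP; apply: measurable_funM => //; exact: measurable_mconv.
- exact: measurable_fubini_F integrable_Hk.
- by move: integrable_H; apply: filterS => x ix _; rewrite inner_x.
rewrite (Fubini integrable_Hk).
apply: eq_integral => u _ /=.
have [u0|u0] := leP u 0%R.
  rewrite f_pos// mul0r; apply: integral0_eq => x _.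
  by rewrite /H f_pos// !mul0r.
rewrite -/(Rintegral _ _ _).
rewrite (@eq_integral _ _ _ mu setT
    (fun x => (fun y => (f u / u)%:E * (g y * k (u * y))%:E) (x / u)%R)); last first.
  move=> x _ /=; rewrite -EFinM /H; congr EFin.
  have -> : (u * (x / u) = x)%R by rewrite mulrCA divff ?mulr1// gt_eqF.
  by ring.
rewrite (@integral_scale _ u u0 (fun y => (f u / u)%:E * (g y * k (u * y))%:E)); last first.
  exact: integrableZl (igk u0).
rewrite (integralZl measurableT (igk u0)).
rewrite muleA -EFinM -(fineK (integrable_fin_num _ (igk u0)))// -EFinM; congr EFin.
rewrite mulrCA divff ?gt_eqF// mulr1//.
Qed.

End kernel.

End MultiplicativeConvolution.

(** * The Mellin transform of the functions phi *)

Section MellinTransform.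
Variable R : realType.
Local Notation mu := (@lebesgue_measure R).
Local Notation RT := (measurableTypeR R).
Implicit Types (f g : RT -> R) (s z : R[i]).

(** The class of functions, stable under convolution, on which the Mellin
    transform at the abscissa [p] converges absolutely and is multiplicative. *)
Record mellin_admissible f p : Prop := MellinAdmissible {
  adm_measurable : measurable_fun setT f ;
  adm_ge0 : forall x, 0 <= f x ;
  adm_pos : forall x, x <= 0 -> f x = 0 ;
  adm_integrable : mu.-integrable setT (EFin \o (fun x => f x * x `^ (- 1 - p))) }.

Lemma mellin_admissible_integrable f s : mellin_admissible f (complex.Re s) ->
  cintegrable setT (mellin_kernel f s).
Proof. by move=> [mf f0 _ fi]; exact: cintegrable_mellin_kernel. Qed.

Lemma mellin_admissible_mconv f g p : mellin_admissible f p ->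
  mellin_admissible g p -> mellin_admissible (mconv f g) p.
Proof.
move=> [mf f0 fp fi] [mg g0 gp gi]; split.
- exact: measurable_mconv.
- by move=> x; exact: mconv_ge0.
- move=> x x0; rewrite /mconv /Rintegral integral0_eq// => u _.
  have [u0|u0] := leP u 0; first by rewrite fp// !mul0r.
  by rewrite gp ?mulr0 ?mul0r// pmulr_lle0// invr_gt0.
- apply: (integrable_mconv mf mg f0 g0 fp gp fi gi) => //.
  by move=> x _; rewrite ger0_norm// powR_ge0.
Qed.

(** As [cpow (u * y) z = cpow u z * cpow y z], the iterated integral of
    [Rintegral_mconv] is a product.  That lemma is about real kernels, hence is
    used once for each part. *)
Lemma cintegral_mconv f g s :
  mellin_admissible f (complex.Re s) -> mellin_admissible g (complex.Re s) ->
  cintegral setT (mellin_kernel (mconv f g) s) =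
  cintegral setT (mellin_kernel f s) * cintegral setT (mellin_kernel g s).
Proof.
move=> af ag.
have [ifr ifi] := mellin_admissible_integrable af.
have igc := mellin_admissible_integrable ag.
case: (af) (ag) => mf f0 fp fi [mg g0 gp gi].
have inner u : cintegral setT (fun y => (g y)%:C * cpow (u * y) (- 1 - s)) * (f u)%:C =
    mellin_kernel f s u * cintegral setT (mellin_kernel g s).
  have [u0|u0] := leP u 0; first by rewrite /mellin_kernel fp// mulr0 !mul0r.
  rewrite (@eq_cintegral _ _ (fun y => cpow u (- 1 - s) * mellin_kernel g s y)).
    by rewrite cintegralZl// /mellin_kernel mulrC mulrA.
  move=> y _; rewrite /mellin_kernel; have [y0|y0] := leP y 0.
    by rewrite gp// !mul0r mulr0.
  by rewrite cpowM// mulrCA.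
have ifc := mellin_admissible_integrable af.
rewrite mulrC -cintegralZl//; apply: complex_eqP.
- transitivity (\int[mu]_x (mconv f g x * complex.Re (cpow x (- 1 - s)))).
    by apply: eq_Rintegral => x _; rewrite Re_mellin_kernel.
  rewrite (@Rintegral_mconv _ _ _ _ mf mg f0 g0 fp gp fi gi); last 2 first.
  + exact: measurable_Re_cpow.
  + by move=> x _; rewrite (le_trans (normr_Re_cpow _ _))// !cpartE.
  apply: eq_Rintegral => u _; rewrite mulrC [cintegral _ _ * _]mulrC -inner cReM mulr0 subr0.
  by congr (_ * _); apply: eq_Rintegral => y _; rewrite cReM mul0r subr0.
- transitivity (\int[mu]_x (mconv f g x * complex.Im (cpow x (- 1 - s)))).
    by apply: eq_Rintegral => x _; rewrite Im_mellin_kernel.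
  rewrite (@Rintegral_mconv _ _ _ _ mf mg f0 g0 fp gp fi gi); last 2 first.
  + exact: measurable_Im_cpow.
  + by move=> x _; rewrite (le_trans (normr_Im_cpow _ _))// !cpartE.
  apply: eq_Rintegral => u _; rewrite mulrC [cintegral _ _ * _]mulrC -inner cImM mulr0 add0r.
  by congr (_ * _); apply: eq_Rintegral => y _; rewrite cImM mul0r addr0.
Qed.

(* phi n restricted to the half-line on which it is considered. *)
(** Extended by [0], so that [phi n] meets the support condition of
    [mellin_admissible]; the recursion is then [phi_posS]. *)
Definition phi_pos n : R -> R := phi n \_ `]0, +oo[.

Lemma phi_posE n x : 0 < x -> phi_pos n x = phi n x.
Proof. by move=> x0; rewrite /phi_pos patchE mem_set //= in_itv /= x0. Qed.

Lemma phi_pos_le0 n x : x <= 0 -> phi_pos n x = 0.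
Proof.
by move=> x0; rewrite /phi_pos patchE memNset //= in_itv /= andbT; apply/negP; rewrite -leNgt.
Qed.

Lemma phi_posS n : phi_pos n.+2 = mconv (phi_pos 1) (phi_pos n.+1).
Proof.
apply/funext => x; have [x0|x0] := leP x 0.
  rewrite phi_pos_le0// /mconv /Rintegral integral0_eq// => u _.
  have [u0|u0] := leP u 0; first by rewrite phi_pos_le0// !mul0r.
  by rewrite (phi_pos_le0 n.+1) ?mulr0 ?mul0r// pmulr_lle0// invr_gt0.
rewrite phi_posE//= Rintegral_mkcond; apply: eq_Rintegral => u _.
have [u0|u0] := leP u 0.
  rewrite phi_pos_le0// !mul0r patchE memNset //= in_itv /= andbT.
  by apply/negP; rewrite -leNgt.
rewrite (phi_posE 1)// (phi_posE n.+1) ?divr_gt0// patchE mem_set //=.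
by rewrite in_itv /= u0.
Qed.

Lemma cintegral_phi_pos n s :
  cintegral setT (mellin_kernel (phi_pos n) s) =
  cintegral `]0, +oo[ (fun x => (phi n x)%:C * cpow x (- 1 - s)).
Proof.
apply: complex_eqP; rewrite /= [RHS]Rintegral_mkcond; apply: eq_Rintegral => x _;
  by rewrite /mellin_kernel /phi_pos !patchE; case: ifPn => // _;
     rewrite /= !mul0r ?subr0 ?addr0.
Qed.

Lemma mellin_admissible_fract p : 0 < p -> p < 1 -> mellin_admissible (phi_pos 1) p.
Proof.
move=> p0 p1; split.
- apply/(measurable_restrictT _ _).1 => //; apply: measurable_funTS.
  exact: measurable_fract_part.
- by move=> x; rewrite /phi_pos patchE; case: ifPn => // _; exact: fract_part_ge0.
- by move=> x; exact: phi_pos_le0.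
- have := integrable_fract_powR_oy p0 p1.
  rewrite integrable_mkcond// restrict_EFin.
  congr (integrable _ _ (EFin \o _)); apply/funext => x.
  by rewrite /phi_pos !patchE; case: ifPn => // _; rewrite mul0r.
Qed.

Lemma mellin_admissible_phi_pos n p : 0 < p -> p < 1 ->
  mellin_admissible (phi_pos n.+1) p.
Proof.
move=> p0 p1; have a1 := mellin_admissible_fract p0 p1.
by elim: n => // n IH; rewrite phi_posS; exact: mellin_admissible_mconv.
Qed.

Lemma cintegral_phi_pos_exp n s : 0 < complex.Re s -> complex.Re s < 1 ->
  cintegral setT (mellin_kernel (phi_pos n.+1) s) =
  cintegral setT (mellin_kernel (phi_pos 1) s) ^+ n.+1.
Proof.
move=> s0 s1; elim: n => // n IH.
rewrite phi_posS cintegral_mconv ?IH ?exprS//; exact: mellin_admissible_phi_pos.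
Qed.

Lemma cintegrable_phi n s : 0 < complex.Re s -> complex.Re s < 1 ->
  cintegrable `]0, +oo[ (fun x => (phi n.+1 x)%:C * cpow x (- 1 - s)).
Proof.
move=> s0 s1.
have i := mellin_admissible_integrable (mellin_admissible_phi_pos n s0 s1).
apply: (@eq_cintegrable _ _ (mellin_kernel (phi_pos n.+1) s)) => //.
  by move=> x /=; rewrite in_itv /= andbT => x0; rewrite /mellin_kernel phi_posE.
exact: cintegrableS i.
Qed.

End MellinTransform.

Theorem theorem2 (R : realType) (zeta : R[i] -> R[i])
    (hzeta : is_riemann_zeta zeta) (n : nat) (hn : (1 <= n)%N)
    (sigma t : R) (hsigma0 : 0 < sigma) (hsigma1 : sigma < 1) :
  let s : R[i] := sigma +i* t in
  let F : R -> R[i] := fun x => (phi n x)%:C * cpow x (- 1 - s) in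
  cintegrable `]0, +oo[ F /\
  zeta s ^+ n / (- s) ^+ n = cintegral `]0, +oo[ F.
Proof.
case: n hn => // n _ s F; split; first exact: cintegrable_phi.
rewrite -cintegral_phi_pos cintegral_phi_pos_exp// cintegral_phi_pos -expr_div_n.
by rewrite zeta_mellin.
Qed.
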